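(* Let $\mathcal{F}$ and $\mathcal{G}$ be symmetric, $C^{1+\alpha}$-diffeomorphic iterated function systems defined on the same closed interval $I$. Suppose $C(\mathcal{F}) \neq C(\mathcal{G})$ and $f'(x) \in (0,1/2)$ for every $f \in \mathcal{F} \cup \mathcal{G}$ and every $x \in I$. Let $\mathbf{W} = (\mathcal{W}_n)_{n\in\mathbb{N}} \in \{\mathcal{F},\mathcal{G}\}^{\mathbb{N}}$ and suppose there exists a $C^{1+\beta}$-diffeomorphic iterated function system $\mathcal{H}$ such that $C(\mathbf{W}) = C(\mathcal{H})$. Then $\mathbf{W}$ is eventually periodic.
   Context: Closed intervals are compact intervals of positive length. Let $D\subset\mathbb{R}$ be a finite union of closed intervals. An iterated function system (IFS) defined on $D$ is a finite nonempty family $\mathcal{F}=\{f_1,\dots,f_k\}$ of continuous contracting functions $f_i\colon D\to D$ (Lipschitz with constant $<1$) with pairwise disjoint images. It induces a map on compact subsets of $D$, denoted by the corresponding standard letter: $F(K)=\bigcup_{i=1}^k f_i(K)$. The limit set of $\mathcal{F}$ is $C(\mathcal{F})=\bigcap_{n=0}^\infty F^n(D)$. If $\mathcal{F},\mathcal{G}$ are two IFSs on the same $D$ and $\mathbf{W}=(\mathcal{W}_n)_{n\in\mathbb{N}}\in\{\mathcal{F},\mathcal{G}\}^{\mathbb{N}}$ (indexed by $n\ge 1$), then $C(\mathbf{W})=\bigcap_{n=1}^\infty (W_1\circ\cdots\circ W_n)(D)$, where $W_n=F$ if $\mathcal{W}_n=\mathcal{F}$ and $W_n=G$ if $\mathcal{W}_n=\mathcal{G}$.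 For $\alpha\in(0,1]$, an IFS is $C^{1+\alpha}$-diffeomorphic if each of its maps is a $C^{1+\alpha}$ diffeomorphism onto its image (differentiable, with nowhere vanishing, $\alpha$-Hölder continuous derivative). The exponents $\alpha,\beta\in(0,1]$ are arbitrary, and the IFS $\mathcal{H}$ is defined on some finite union of closed intervals, which is not required to be $I$. An IFS $\mathcal{F}$ defined on an interval $I=[c-r,c+r]$ is symmetric if for each $f\in\mathcal{F}$ there exists $\overline{f}\in\mathcal{F}$ such that $\overline{f}(x)-c=c-f(2c-x)$ for all $x\in I$. $\mathbf{W}$ is eventually periodic if there are $N,p\ge 1$ with $\mathcal{W}_{n+p}=\mathcal{W}_n$ for all $n\ge N$. *)

(* Defs.v *)
From HB Require Import structures.
From mathcomp Require Import all_boot all_order all_algebra.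
From mathcomp Require Import all_classical all_reals all_analysis.

Set Implicit Arguments.
Unset Strict Implicit.
Unset Printing Implicit Defensive.

Import Order.TTheory GRing.Theory Num.Theory numFieldNormedType.Exports.

Local Open Scope classical_set_scope.
Local Open Scope ring_scope.

Section Definitions.
Context {R : realType}.
Implicit Types (D K : set R) (f : R -> R) (x : R).

Definition finite_union_of_closed_intervals D : Prop :=
  exists (n : nat) (a b : 'I_n.+1 -> R),
    (forall i, a i < b i) /\ D = \bigcup_i `[a i, b i]%classic.

(* The maps are total functions on R; only their values on D matter. *)
Record ifs D : Type := Ifs {
  ifs_pred_size : nat;
  ifs_map :> 'I_ifs_pred_size.+1 -> R -> R;
  ifs_domain : finite_union_of_closed_intervals D;
  ifs_maps_to : forall i x, D x -> D (ifs_map i x);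
  ifs_continuous : forall i, {within D, continuous (ifs_map i)};
  ifs_contracting : forall i, exists2 q : R, q < 1 & q.-lipschitz_D (ifs_map i);
  ifs_disjoint : forall i j, i != j ->
    (ifs_map i @` D) `&` (ifs_map j @` D) = set0
}.

Definition ifs_act D (F : ifs D) K : set R := \bigcup_i (F i @` K).

Definition limit_set D (F : ifs D) : set R :=
  \bigcap_(n in [set: nat]) iter n (ifs_act F) D.

(* Sequences of IFSs are indexed from 1, so that [W 0] is never used; the
   [foldr] below is (W_1 o ... o W_n)(D), with W_n applied first. *)
Definition mixed_limit_set D (W : nat -> ifs D) : set R :=
  \bigcap_(n in [set n | (1 <= n)%N])
    foldr (fun i K => ifs_act (W i) K) D (iota 1%N n).

Definition eventually_periodic (T : Type) (W : nat -> T) : Prop :=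
  exists N p : nat, [/\ (1 <= N)%N, (1 <= p)%N &
    forall n, (N <= n)%N -> W (n + p)%N = W n].

(* Derivative relative to D: one-sided at the endpoints of its components. *)
Definition diff_quotient f x : R -> R := fun y => (f y - f x) / (y - x).

Definition derivable_in D f x : Prop :=
  cvg (diff_quotient f x @ within D x^').

Definition derive_in D f x : R := lim (diff_quotient f x @ within D x^').

Definition hoelder_on D (alpha : R) f : Prop :=
  exists M : R, forall x y, D x -> D y -> `|f x - f y| <= M * `|x - y| `^ alpha.

(* Injectivity is not automatic, since D may be disconnected. *)
Definition C1_diffeo_on D (alpha : R) f : Prop :=
  [/\ {in D &, injective f},
      forall x, D x -> derivable_in D f x,
      forall x, D x -> derive_in D f x != 0 &
      hoelder_on D alpha (derive_in D f)].

Definition C1_diffeomorphic D (alpha : R) (F : ifs D) : Prop :=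
  forall i, C1_diffeo_on D alpha (F i).

(* Stated for D = [c - r, c + r]; c is the centre of symmetry. *)
Definition symmetric_ifs D (c : R) (F : ifs D) : Prop :=
  forall i, exists j, forall x, D x -> F j x - c = c - F i (2 * c - x).

End Definitions.

(* Main.v *)
Require Import Defs.
From HB Require Import structures.
From mathcomp Require Import all_boot all_order all_algebra.
From mathcomp Require Import all_classical all_reals all_analysis.
From mathcomp Require Import ring lra.

Set Implicit Arguments.
Unset Strict Implicit.
Unset Printing Implicit Defensive.

Import Order.TTheory GRing.Theory Num.Theory numFieldNormedType.Exports.

Local Open Scope classical_set_scope.
Local Open Scope ring_scope.

(** Why the theorem holds.

Write C(V) for the limit set of a sequence V of the two systems F and G, and
sigma^n W for the n-th tail of W.  The aim is to find m < n with
sigma^m W = sigma^n W; this is eventual periodicity.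

Self-similarity comes from H.  A map of H has a fixed point z in
C(H) = C(W).  Its square h has a multiplier lam in (0, 1) at z, maps C(W)
into itself, and covers a neighbourhood of z in C(W).  Because the
derivative of h is Hoelder continuous, h^l is uniformly close to the
homothety of ratio lam^l near z, for all l at once
([ifs_linear_fixpoint]).  On the other side, z lies in a nested sequence of
cylinders of C(W), coded by a word w, and the n-th one is the image of
C(sigma^n W) under the composition of the first n maps of the word.  Fix s0
and s1 large.  The first m of the first m + s0 maps act almost affinely on
the image of the s0 others, again by Hoelder continuity of derivatives
([word_slope]).  By the pigeonhole principle there are m < n such that the
letters of w at the positions m, ..., m + s0 + s1 - 1 and n, ...,
n + s0 + s1 - 1 agree, and the ratio between the two prefix derivatives is
nearly lam^l for some l ([scale_bins]).  Then h^l maps the cylinder of rank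
m + s0 onto the one of rank n + s0, since distinct cylinders of the same rank
are well separated at their own scale ([cyl_isolated]).  Read in the
coordinates of the common suffix v, this is a relation between v(C(V)) and
v(C(V')), with V and V' the tails of rank m + s0 and n + s0, which is nearly
isometric: differences of points are preserved up to a small relative error.

The rest of the proof is that such a relation forces V = V' ([rigidity]).
Two facts carry it.

- Symmetry prevents drift.  C(V) and C(V') have the same centre of symmetry
  c, so the displacements of related points cannot all be bounded away from 0
  with the same sign ([no_drift]); since they differ by little at the scale
  of the cylinder, they are all small at this scale ([displacement_small]).
  This control does not degrade when one passes to deeper cylinders, because
  the near isometry is measured in the fixed outer coordinates.

- C(V) determines the first term of V, in a uniform way ([separation]).  The
  operators F and G contract the Hausdorff distance by a factor q < 1/2 and
  have the distinct fixed points C(F) and C(G).  If F(A) and G(B) were very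
  close for some sets A, B of the compact invariant family of all C(V), of
  diameter d, then d would be at most 2 q d plus this small distance, and
  this would make C(F) and C(G) too close.

So V and V' have the same first term; small displacements do not cross the
gaps between first-level pieces, hence the relation restricts to any such
piece, and the argument is repeated for the next term. *)

(** * Closeness up to a factor *)

Section LogClose.
Context {R : realType}.
Implicit Types (e X Y Z : R).

(** The factor is written as an exponential because errors then add up under
    composition, and the relation is symmetric with no change of constant. *)
Definition logclose e X Y := exists2 t, `|t| <= e & X = Y * expR t.

Lemma logclose_refl e X : 0 <= e -> logclose e X X.
Proof. by move=> e0; exists 0; rewrite ?normr0 ?expR0 ?mulr1. Qed.

Lemma logclose_sym e X Y : logclose e X Y -> logclose e Y X.
Proof.
by move=> [t te ->]; exists (- t); rewrite ?normrN// -mulrA -expRD subrr expR0 mulr1.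
Qed.

Lemma logclose_trans e1 e2 X Y Z :
  logclose e1 X Y -> logclose e2 Y Z -> logclose (e1 + e2) X Z.
Proof.
move=> [t te ->] [u ue ->]; exists (u + t); last by rewrite expRD mulrA.
by rewrite (le_trans (ler_normD _ _))// addrC lerD.
Qed.

Lemma logcloseMl e a X Y : logclose e X Y -> logclose e (a * X) (a * Y).
Proof. by move=> [t te ->]; exists t; rewrite ?mulrA. Qed.

Lemma logcloseMr e a X Y : logclose e X Y -> logclose e (X * a) (Y * a).
Proof. by rewrite ![_ * a]mulrC; exact: logcloseMl. Qed.

Lemma logcloseMI e a X Y : a != 0 -> logclose e (a * X) (a * Y) -> logclose e X Y.
Proof.
move=> a0 [t te XY]; exists t => //.
by apply: (mulfI a0); rewrite XY mulrA.
Qed.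

Lemma le_logclose e e' X Y : e <= e' -> logclose e X Y -> logclose e' X Y.
Proof. by move=> ee [t te ->]; exists t => //; exact: le_trans ee. Qed.

Lemma logclose_norm_le e X Y : logclose e X Y -> `|X| <= expR e * `|Y|.
Proof.
move=> [t te ->]; rewrite normrM mulrC ler_wpM2r//.
by rewrite ger0_norm ?expR_ge0// ler_expR (le_trans (ler_norm _)).
Qed.

Lemma logclose_norm_ge e X Y : logclose e X Y -> `|Y| <= expR e * `|X|.
Proof. by move/logclose_sym/logclose_norm_le. Qed.

(** Comes from [1 + t <= expR t] at [t] and at [- t]; the latter gives
    [expR t * (1 - t) <= 1]. *)
Lemma expR_sub1_le (t e : R) : `|t| <= e -> e <= 1 / 2 -> `|expR t - 1| <= 2 * e.
Proof.
move=> te e2; have := te; rewrite ler_norml => /andP[t1 t2].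
have e0 : 0 <= e by exact: le_trans (normr_ge0 _) te.
have h1 := expR_ge1Dx t; have h2 := expR_ge1Dx (- t).
have p := expR_gt0 t.
have : expR t * expR (- t) = 1 by rewrite -expRD subrr expR0.
move=> h3; rewrite ler_norml; apply/andP; split.
  lra.
have h4 : expR t * (1 - t) <= expR t * expR (- t) by rewrite ler_wpM2l// ltW.
nra.
Qed.

Lemma logclose_dist e X Y : e <= 1 / 2 -> logclose e X Y -> `|X - Y| <= 2 * e * `|Y|.
Proof.
move=> e2 [t te ->]; rewrite -{2}(mulr1 Y) -mulrBr normrM mulrC ler_wpM2r//.
exact: expR_sub1_le.
Qed.

Lemma logclose_ratio e X Y : 0 < X -> 0 < Y ->
  `|ln X - ln Y| <= e -> logclose e X Y.
Proof.
move=> X0 Y0 XY; exists (ln X - ln Y) => //.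
by rewrite expRD expRN !lnK ?posrE// mulrCA divff ?mulr1 ?gt_eqF.
Qed.

End LogClose.

(** * Maps with Hoelder continuous derivative *)

(** In the interior of an interval the derivative relative to a larger set is
    the usual one, so that the mean value theorem applies. *)
Lemma is_derive_in (R : realType) (D : set R) (f : R -> R) (a b x : R) :
  `[a, b]%classic `<=` D -> x \in `]a, b[ -> derivable_in D f x ->
  is_derive x 1 f (derive_in D f x).
Proof.
move=> abD; rewrite in_itv /= => /andP[ax xb] fx.
have cvgf : (fun h : R => h^-1 *: ((f \o shift x) (h *: 1) - f x)) @ 0^'
    --> (derive_in D f x : R^o).
  apply/cvgrPdist_le => e e0.
  have /cvgrPdist_le /(_ e e0) := fx.
  rewrite -/(derive_in D f x) => /nbhs_ballP [d /= d0 H].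
  apply/nbhs_ballP; exists (Num.min d (Num.min (x - a) (b - x))) => /=.
    by rewrite !lt_min d0 !subr_gt0 ax xb.
  move=> h /=; rewrite /ball /= sub0r normrN !lt_min => /and3P[hd].
  rewrite !ltr_norml => /andP[h1 h2] /andP[h3 h4] hn0.
  have := H (h + x); rewrite /ball /= /diff_quotient opprD addrCA subrr addr0 normrN.
  move=> /(_ hd); rewrite addrK /= [_ *: 1]mulr1 [_ *: _]mulrC; apply.
    by rewrite -subr_eq0 addrK.
  by apply: abD; rewrite /= in_itv /=; apply/andP; split; lra.
by split; [apply/cvg_ex; exists (derive_in D f x)|exact/cvg_lim].
Qed.

Lemma MVT_in (R : realType) (D : set R) (f : R -> R) (a b u v : R) :
    `[a, b]%classic `<=` D -> {within D, continuous f} ->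
    (forall x, x \in `[a, b] -> derivable_in D f x) ->
    u \in `[a, b] -> v \in `[a, b] -> u < v ->
  exists2 xi, xi \in `]u, v[ & f v - f u = derive_in D f xi * (v - u).
Proof.
move=> abD fc df uab vab uv.
have subi z : z \in `[u, v] -> z \in `[a, b].
  move: uab vab; rewrite !in_itv /= => /andP[? ?] /andP[? ?] /andP[? ?].
  by apply/andP; split; lra.
apply: (MVT uv).
  move=> z zuv; have /subi zab : z \in `[u, v] by exact: subset_itv_oo_cc zuv.
  apply: (is_derive_in _ zuv); last exact: df.
  by move=> t /subi; exact: abD.
apply: continuous_subspaceW fc => t /subi; exact: abD.
Qed.

(** By the mean value theorem a difference quotient is a value of the derivative
    at distance at most [d] from [x0], and the logarithm of a function bounded
    away from 0 is as regular as the function. *)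
Lemma holder_slope (R : realType) (D : set R) (f : R -> R) (a b M l alpha : R) :
    0 <= alpha -> 0 <= M -> 0 < l ->
    `[a, b]%classic `<=` D -> {within D, continuous f} ->
    (forall x, x \in `[a, b] -> derivable_in D f x) ->
    (forall x, x \in `[a, b] -> l <= `|derive_in D f x|) ->
    (forall x y, x \in `[a, b] -> y \in `[a, b] ->
       0 < derive_in D f x * derive_in D f y) ->
    (forall x y, x \in `[a, b] -> y \in `[a, b] ->
       `|derive_in D f x - derive_in D f y| <= M * `|x - y| `^ alpha) ->
  forall x0 d x y, x0 \in `[a, b] -> x \in `[a, b] -> y \in `[a, b] ->
    `|x - x0| <= d -> `|y - x0| <= d ->
  logclose (M / l * d `^ alpha) (f x - f y) (derive_in D f x0 * (x - y)).
Proof.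
move=> al0 M0 l0 abD fc df lb sg hol x0 d x y x0ab.
have key u v : u \in `[a, b] -> v \in `[a, b] ->
    `|u - x0| <= d -> `|v - x0| <= d -> u < v ->
    logclose (M / l * d `^ alpha) (f v - f u) (derive_in D f x0 * (v - u)).
  move=> uab vab ud vd uv.
  have subi z : z \in `[u, v] -> z \in `[a, b].
    move: uab vab; rewrite !in_itv /= => /andP[? ?] /andP[? ?] /andP[? ?].
    by apply/andP; split; lra.
  have [xi xiuv ->] := MVT_in abD fc df uab vab uv.
  apply: logcloseMr.
  have /subi xiab : xi \in `[u, v] by exact: subset_itv_oo_cc xiuv.
  have xid : `|xi - x0| <= d.
    move: ud vd xiuv; rewrite in_itv /= !ler_norml => /andP[? ?] /andP[? ?] /andP[? ?].
    by apply/andP; split; lra.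
  set A := derive_in D f xi; set B := derive_in D f x0.
  have AB0 : 0 < A * B by exact: sg.
  have lA : l <= `|A| by exact: lb.
  have lB : l <= `|B| by exact: lb.
  have AB : `|A - B| <= M * d `^ alpha.
    apply: le_trans (hol _ _ xiab x0ab) _; rewrite ler_wpM2l//.
    by apply: ge0_ler_powR; rewrite ?nnegrE// (le_trans _ xid).
  have B0 : B != 0 by rewrite -normr_gt0; exact: lt_le_trans lB.
  have A0 : A != 0 by rewrite -normr_gt0; exact: lt_le_trans lA.
  have r0 : 0 < A / B.
    have -> : A / B = A * B * (B^-1 ^+ 2) by field.
    by rewrite mulr_gt0// exprn_even_gt0//= invr_eq0.
  have bound P Q : P != 0 -> l <= `|P| -> `|Q - P| <= M * d `^ alpha ->
      Q / P - 1 <= M / l * d `^ alpha.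
    move=> P0 lP QP; have -> : Q / P - 1 = (Q - P) / P by field.
    apply: le_trans (ler_norm _) _; rewrite normrM normfV.
    rewrite ler_pdivrMr ?normr_gt0//; apply: le_trans QP _.
    have -> : M / l * d `^ alpha * `|P| = M * d `^ alpha * (`|P| / l).
      by field; rewrite gt_eqF.
    by rewrite ler_peMr ?mulr_ge0 ?powR_ge0// ler_pdivlMr// mul1r.
  have lnle (t : R) : 0 < t -> ln t <= t - 1.
    move=> t0; rewrite -ler_expR lnK ?posrE//.
    by apply: le_trans (expR_ge1Dx _); rewrite addrC subrK.
  exists (ln (A / B)); last by rewrite lnK ?posrE// mulrCA divff// mulr1.
  rewrite ler_norml; apply/andP; split.
    rewrite lerNl -lnV ?posrE// invf_div.
    apply: le_trans (lnle _ _) (bound _ _ A0 lA _); last by rewrite distrC.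
    by rewrite -invf_div invr_gt0.
  exact: le_trans (lnle _ r0) (bound _ _ B0 lB _).
move=> xab yab xd yd; have [xy|yx|->] := ltgtP x y.
- have [t te E] := key _ _ xab yab xd yd xy.
  by exists t => //; rewrite -opprB E -[x - y]opprB mulrN mulNr.
- exact: key.
- rewrite !subrr mulr0; apply: logclose_refl.
  by rewrite mulr_ge0 ?powR_ge0// divr_ge0// ltW.
Qed.

(** * Compositions of nearly affine contractions *)

(** In [na_slope] the error exponent decays with the distance [d] to the
    reference point.  This is what makes the errors of a composition summable:
    along a contracting composition the distances decay geometrically. *)
Record nearly_affine {R : realType} {L : Type} (S : set R)
    (phi der : L -> R -> R) (q M alpha : R) : Prop := NearlyAffine {
  na_q : 0 < q < 1;
  na_alpha : 0 < alpha;
  na_M : 0 <= M;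
  na_stable : forall i x, S x -> S (phi i x);
  na_contract : forall i x y, S x -> S y ->
    `|phi i x - phi i y| <= q * `|x - y|;
  na_slope : forall i x0 d x y, S x0 -> S x -> S y ->
    `|x - x0| <= d -> `|y - x0| <= d ->
    logclose (M * d `^ alpha) (phi i x - phi i y) (der i x0 * (x - y)) }.

Section Composition.
Context {R : realType} {L : Type} (phi der : L -> R -> R).
Implicit Types (s t : seq L) (x y : R).

Definition word_map s x : R := foldr phi x s.

(** The chain rule product along the orbit of [x]. *)
Fixpoint word_deriv s x : R :=
  if s is i :: s' then der i (word_map s' x) * word_deriv s' x else 1.

Lemma word_map_cat s t x : word_map (s ++ t) x = word_map s (word_map t x).
Proof. exact: foldr_cat. Qed.

Lemma word_deriv_cat s t x :
  word_deriv (s ++ t) x = word_deriv s (word_map t x) * word_deriv t x.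
Proof.
elim: s => [|i s IH] /=; first by rewrite mul1r.
by rewrite IH word_map_cat mulrA.
Qed.

Context (S : set R) (q M alpha : R) (na : nearly_affine S phi der q M alpha).

Lemma word_map_stable s x : S x -> S (word_map s x).
Proof. by move=> Sx; elim: s => //= i s IH; exact: na_stable na _ _ _. Qed.

Lemma word_map_contract s x y : S x -> S y ->
  `|word_map s x - word_map s y| <= q ^+ size s * `|x - y|.
Proof.
move=> Sx Sy; elim: s => /= [|i s IH]; first by rewrite mul1r.
have Sc := @word_map_stable s.
apply: le_trans (na_contract na _ (Sc _ Sx) (Sc _ Sy)) _.
by rewrite exprS -mulrA ler_wpM2l//; case/andP: (na_q na) => /ltW.
Qed.

(** The sum of the geometric series of ratio [q `^ alpha] that bounds the errors
    accumulated along a composition. *)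
Definition affine_error : R := M / (1 - q `^ alpha).

Lemma powR_q_lt1 : 0 <= q `^ alpha < 1.
Proof.
case/andP: (na_q na) => q0 q1; rewrite powR_ge0/=.
have : q `^ alpha < 1 `^ alpha.
  by apply: gt0_ltr_powR; rewrite ?nnegrE//; [exact: na_alpha na|exact: ltW].
by rewrite powR1.
Qed.

Lemma affine_error_ge0 : 0 <= affine_error.
Proof.
by apply: divr_ge0; [exact: na_M na|case/andP: powR_q_lt1 => _ h; rewrite subr_ge0 ltW].
Qed.

(** The map applied after [k] others sees points at distance [q ^+ k * d] at most
    of its reference point, so the errors form a geometric series.  The bound is
    independent of the length of the word. *)
Lemma word_slope s x0 d x y : S x0 -> S x -> S y ->
  `|x - x0| <= d -> `|y - x0| <= d ->
  logclose (affine_error * d `^ alpha)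
    (word_map s x - word_map s y) (word_deriv s x0 * (x - y)).
Proof.
move=> S0 Sx Sy xd yd.
have d0 : 0 <= d by exact: le_trans xd.
have /andP[q0 q1] := na_q na; have /andP[k0 k1] := powR_q_lt1.
set k := q `^ alpha in k0 k1.
(* The induction is on the partial sums of the geometric series. *)
apply: (@le_logclose _ (affine_error * (1 - k ^+ size s) * d `^ alpha)).
  rewrite ler_wpM2r ?powR_ge0// ler_piMr ?affine_error_ge0//.
  by rewrite gerBl exprn_ge0.
elim: s => /= [|i s IH].
  by rewrite expr0 subrr mulr0 mul0r mul1r; exact: logclose_refl.
have near z : S z -> `|z - x0| <= d ->
    `|word_map s z - word_map s x0| <= q ^+ size s * d.
  move=> Sz zd; apply: le_trans (word_map_contract _ Sz S0) _.
  by rewrite ler_wpM2l// exprn_ge0// ltW.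
have Sc := @word_map_stable s.
have := na_slope na i (Sc _ S0) (Sc _ Sx) (Sc _ Sy) (near _ Sx xd) (near _ Sy yd).
have := logcloseMl (der i (word_map s x0)) IH.
rewrite mulrA => h1 h2; apply: le_logclose (logclose_trans h2 h1).
rewrite powRM ?exprn_ge0 ?(ltW q0)// -powR_mulrn ?(ltW q0)//.
rewrite powRAC powR_mulrn ?powR_ge0//.
rewrite -/k le_eqVlt; apply/orP; left; apply/eqP.
rewrite exprS /affine_error -/k; field.
by rewrite subr_eq0 eq_sym lt_eqF.
Qed.

End Composition.

(** * Limit sets of sequences of two symmetric systems *)

Lemma expr_small (R : realType) (p B e : R) : 0 <= p < 1 -> 0 <= B -> 0 < e ->
  exists n, p ^+ n * B <= e.
Proof.
move=> /andP[p0 p1] B0 e0.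
have /cvg_expr /cvgrPdist_le /(_ (e / (B + 1))) : `|p| < 1 by rewrite ger0_norm.
have B1 : 0 < B + 1 by rewrite ltr_wpDl.
rewrite divr_gt0// => /(_ isT) [n _ /(_ n (leqnn n))].
rewrite sub0r normrN ger0_norm ?exprn_ge0// ler_pdivlMr// => h; exists n.
by apply: le_trans h; rewrite ler_wpM2l ?exprn_ge0// lerDl.
Qed.

(** Both systems at once: the letters are the maps of the two systems together,
    and [kind] tells from which one a letter comes.  A sequence of systems is thus
    a boolean sequence, and its limit set consists of the points coded by letters
    of the prescribed kinds. *)
Record symmetric_pair {R : realType} (c r : R) {L : finType} (kind : L -> bool)
    (phi der : L -> R -> R) (q M alpha gap : R) : Prop := SymmetricPair {
  sp_r : 0 < r;
  sp_na : nearly_affine `[c - r, c + r]%classic phi der q M alpha;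
  sp_q : q < 1 / 2;
  sp_der : forall i x, `[c - r, c + r]%classic x -> 0 < der i x < 1;
  sp_gap : 0 < gap;
  sp_sep : forall i j x y, kind i = kind j -> i != j ->
    `[c - r, c + r]%classic x -> `[c - r, c + r]%classic y ->
    gap <= `|phi i x - phi j y|;
  sp_sym : forall i, exists2 j, kind j = kind i & forall x,
    `[c - r, c + r]%classic x -> phi j x - c = c - phi i (2 * c - x);
  sp_kind : forall b, exists i, kind i = b }.

Definition tail (n : nat) (V : nat -> bool) : nat -> bool := fun k => V (n + k)%N.

Lemma tail_tail m n V : tail m (tail n V) = tail (n + m) V.
Proof. by apply/funext => k; rewrite /tail addnA. Qed.

Section LimitSets.
Context {R : realType} (c r : R) {L : finType} (kind : L -> bool)
  (phi der : L -> R -> R) (q M alpha gap : R).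

Local Notation Itv := (`[c - r, c + r]%classic : set R).
Local Notation comp := (word_map phi).
Local Notation slope := (word_deriv phi der).

Definition pieces (b : bool) (K : set R) : set R :=
  [set x | exists i y, [/\ kind i = b, K y & x = phi i y]].

Fixpoint cyl (V : nat -> bool) (n : nat) : set R :=
  if n is n'.+1 then pieces (V 0%N) (cyl (tail 1 V) n') else Itv.

Definition lim_set (V : nat -> bool) : set R := \bigcap_n cyl V n.

Fixpoint matches (V : nat -> bool) (s : seq L) : Prop :=
  if s is i :: s' then kind i = V 0%N /\ matches (tail 1 V) s' else True.

Context (sp : symmetric_pair c r kind phi der q M alpha gap).

Let na : nearly_affine Itv phi der q M alpha := sp_na sp.

Lemma r_gt0 : 0 < r. Proof. exact: sp_r sp. Qed.

Lemma q_bounds : 0 < q < 1 / 2.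
Proof. by case/andP: (na_q na) => -> _; exact: sp_q sp. Qed.

Lemma phi_stable i x : Itv x -> Itv (phi i x).
Proof. exact: na_stable na _ _. Qed.

Lemma word_deriv_gt0 s x : Itv x -> 0 < slope s x.
Proof.
move=> Ix; elim: s => //= i s IH; rewrite mulr_gt0//.
by have /andP[] := sp_der sp i (word_map_stable na s Ix).
Qed.

Lemma word_map_lt s x y : Itv x -> Itv y -> x < y -> comp s x < comp s y.
Proof.
move=> Ix Iy xy; rewrite -subr_gt0.
have [t _ ->] := word_slope na s (d := `|y - x|) Ix Iy Ix (lexx _)
  ltac:(by rewrite subrr normr0).
by rewrite !mulr_gt0 ?expR_gt0 ?word_deriv_gt0// subr_gt0.
Qed.

Lemma word_map_le s x y : Itv x -> Itv y -> x <= y -> comp s x <= comp s y.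
Proof.
by move=> Ix Iy; rewrite le_eqVlt => /predU1P[->//|/(word_map_lt s Ix Iy)/ltW].
Qed.

Lemma word_map_inj s x y : Itv x -> Itv y -> comp s x = comp s y -> x = y.
Proof.
move=> Ix Iy e; have [/(word_map_lt s Ix Iy)|/(word_map_lt s Iy Ix)|//] := ltgtP x y;
by rewrite e ltxx.
Qed.

Lemma I_refl x : Itv x -> Itv (2 * c - x).
Proof. by rewrite /= !in_itv /= => /andP[? ?]; apply/andP; split; lra. Qed.

Lemma I_left : Itv (c - r).
Proof.
by have := r_gt0; rewrite /= in_itv /= => r0; apply/andP; split; lra.
Qed.

Lemma I_right : Itv (c + r).
Proof.
by have := r_gt0; rewrite /= in_itv /= => r0; apply/andP; split; lra.
Qed.

Lemma I_dist x y : Itv x -> Itv y -> `|x - y| <= 2 * r.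
Proof.
by rewrite /= !in_itv /= ler_norml => /andP[? ?] /andP[? ?]; apply/andP; split; lra.
Qed.

Lemma pieces_sub b K K' : K `<=` K' -> pieces b K `<=` pieces b K'.
Proof. by move=> KK x [i [y [ki Ky ->]]]; exists i, y; split=> //; exact: KK. Qed.

Lemma cyl_subI V n : cyl V n `<=` Itv.
Proof.
elim: n V => [|n IH] V x //= [i [y [_ Ky ->]]]; exact: phi_stable (IH _ _ Ky).
Qed.

Lemma cylS_sub V n : cyl V n.+1 `<=` cyl V n.
Proof.
elim: n V => [|n IH] V; first exact: cyl_subI.
exact/pieces_sub/IH.
Qed.

Lemma cyl_decr V m n : (m <= n)%N -> cyl V n `<=` cyl V m.
Proof.
elim: n => [|n IH]; first by rewrite leqn0 => /eqP ->.
rewrite leq_eqVlt => /predU1P[-> //|/IH h]; exact: subset_trans (@cylS_sub V n) h.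
Qed.

Lemma phi_continuous i : {within Itv, continuous (phi i)}.
Proof.
apply/subspace_continuousP => x Ix; apply/cvgrPdist_le => e e0.
apply/nbhs_ballP; exists e => //= y xy Iy.
apply: le_trans (na_contract na i Ix Iy) _.
have /andP[? ?] := na_q na.
apply: le_trans (ltW xy); rewrite ler_piMl// ltW//.
Qed.

Lemma cyl_compact V n : compact (cyl V n).
Proof.
elim: n V => [|n IH] V; first exact: segment_compact.
have -> : cyl V n.+1 =
    \big[setU/set0]_(i <- enum L | kind i == V 0%N) (phi i @` cyl (tail 1 V) n).
  rewrite -bigcup_seq_cond; apply/seteqP; split => x /=.
    move=> [i [y [ki Ky ->]]]; exists i => /=; last by exists y.
    by rewrite mem_enum/= ki eqxx.
  by move=> [i /= /andP[_ /eqP ki] [y Ky <-]]; exists i, y.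
apply: bigsetU_compact => i _; apply: continuous_compact (IH _).
exact: continuous_subspaceW (@cyl_subI _ _) (@phi_continuous i).
Qed.

Lemma cyl_closed V n : closed (cyl V n).
Proof. by apply: compact_closed; [exact: norm_hausdorff|exact: cyl_compact]. Qed.

Lemma lim_subI V : lim_set V `<=` Itv.
Proof. by move=> x /(_ 0%N I). Qed.

Lemma lim_closed V : closed (lim_set V).
Proof. by apply: closed_bigI => n _; exact: cyl_closed. Qed.

Lemma cyl_nonempty V n : cyl V n !=set0.
Proof.
elim: n V => [|n IH] V; first by exists (c - r); exact: I_left.
have [i ki] := sp_kind sp (V 0%N); have [y Ky] := IH (tail 1 V).
by exists (phi i y), i, y.
Qed.

(** A nested intersection of nonempty compact sets. *)
Lemma lim_nonempty V : lim_set V !=set0.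
Proof.
have /choice [u uV] := cyl_nonempty V.
have [p [Ip clp]] : Itv `&` cluster (u @ \oo) !=set0.
  apply: (@segment_compact _ (c - r) (c + r)).
  by exists 0%N => // n _ /=; exact: cyl_subI (uV n).
exists p => n _; apply: cyl_closed => B nB.
apply: clp => //; exists n => // m /= nm; exact: cyl_decr (uV m).
Qed.

(** The letter and the preimage obtained at each finite rank do not depend on
    the rank, because the pieces are disjoint and the maps injective. *)
Lemma lim_pieces V : lim_set V = pieces (V 0%N) (lim_set (tail 1 V)).
Proof.
apply/seteqP; split => x; last first.
  move=> [i [y [ki Ky ->]]] [_|n _]; first exact/phi_stable/lim_subI/Ky.
  by exists i, y; split => //; exact: Ky.
move=> limx; have [i [y [ki Iy xE]]] := limx 1%N I.
exists i, y; split => // n _.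
have [j [z [kj Kz xE']]] := limx n.+1 I.
have Iz : Itv z := cyl_subI Kz.
have ij : i = j.
  apply/eqP/negPn/negP => ij.
  have := sp_sep sp (etrans ki (esym kj)) ij Iy Iz.
  by rewrite -xE -xE' subrr normr0 leNgt (sp_gap sp).
suff -> : y = z by [].
by apply: (@word_map_inj [:: i]) => //=; rewrite -xE xE' ij.
Qed.

Lemma lim_word_map V s x : matches V s -> lim_set (tail (size s) V) x ->
  lim_set V (comp s x).
Proof.
elim: s V => //= i s IH V [ki ms] limx.
rewrite lim_pieces; exists i, (comp s x); split => //.
by apply: IH => //; rewrite tail_tail.
Qed.

Lemma lim_sym V x : lim_set V x -> lim_set V (2 * c - x).
Proof.
move=> limx n _; have := limx n I; elim: n V x {limx} => [|n IH] V x /=.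
  exact: I_refl.
move=> [i [y [ki Ky ->]]]; have [j kj jE] := sp_sym sp i.
exists j, (2 * c - y); split; [by rewrite kj|exact: IH|].
have := jE _ (I_refl (cyl_subI Ky)).
by rewrite opprB addrCA subrr addr0 => h; lra.
Qed.

End LimitSets.

(** * Separation of limit sets and isolation of cylinders *)

(** One half of closeness for the Hausdorff distance. *)
Definition near_sub {R : realType} (e : R) (A B : set R) : Prop :=
  forall x, A x -> exists2 y, B y & `|x - y| <= e.

Section SeparationIsolation.
Context {R : realType} (c r : R) {L : finType} (kind : L -> bool)
  (phi der : L -> R -> R) (q M alpha gap : R).
Context (sp : symmetric_pair c r kind phi der q M alpha gap).

Local Notation Itv := (`[c - r, c + r]%classic : set R).
Local Notation comp := (word_map phi).
Local Notation slope := (word_deriv phi der).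
Local Notation lim_set := (lim_set c r kind phi).
Local Notation pieces := (pieces kind phi).
Local Notation matches := (matches kind).

Let na : nearly_affine Itv phi der q M alpha := sp_na sp.

Lemma near_sub_pieces b V V' D : 0 <= D -> near_sub D (lim_set V) (lim_set V') ->
  near_sub (q * D) (pieces b (lim_set V)) (pieces b (lim_set V')).
Proof.
move=> D0 VV x [i [y [ki Vy ->]]]; have [y' Vy' yy'] := VV y Vy.
exists (phi i y'); first by exists i, y'.
have /andP[q0 _] := q_bounds sp.
have h := na_contract na i (lim_subI Vy) (lim_subI Vy').
apply: le_trans h _.
by rewrite ler_pM2l.
Qed.

Lemma near_sub_trans (d e : R) (A B C : set R) :
  near_sub d A B -> near_sub e B C -> near_sub (d + e) A C.
Proof.
move=> AB BC x /AB [y /BC [z Cz yz] xy]; exists z => //.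
by rewrite -(subrKA y) (le_trans (ler_normD _ _))// lerD.
Qed.

Lemma near_subW (d e : R) (A B : set R) : d <= e -> near_sub d A B -> near_sub e A B.
Proof. by move=> de AB x /AB [y By xy]; exists y => //; exact: le_trans de. Qed.

Lemma near_sub_closed (A B : set R) : closed B ->
  (forall e, 0 < e -> near_sub e A B) -> A `<=` B.
Proof.
move=> clB AB x Ax; apply: clB => U /nbhs_ballP [e /= e0 eU].
have [y By xy] := AB (e / 2) ltac:(by rewrite divr_gt0) x Ax.
exists y; split => //; apply: eU; rewrite /ball /= (le_lt_trans xy)//.
by rewrite ltr_pdivrMr// ltr_pMr// ltr1n.
Qed.

Let qD d n : R := (2 * q) ^+ n * (2 * r) + d / (1 - 2 * q).

(** Let [D] bound the mutual distances of all limit sets.  Limit sets of the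
    same first kind are [q * D]-close.  If some pair of different first kinds is
    [d]-close, then going through it shows that all pairs are
    [2 * q * D + d]-close.  This is iterated from a bound larger than the length
    [2 * r] of the interval, and converges to [d / (1 - 2 * q)] since
    [2 * q < 1]. *)
Lemma all_near_sub d V V' n : 0 <= d -> V 0%N != V' 0%N ->
  near_sub d (lim_set V) (lim_set V') -> near_sub d (lim_set V') (lim_set V) ->
  forall U U', near_sub (qD d n) (lim_set U) (lim_set U').
Proof.
move=> d0 V01 VV' V'V; have /andP[q0 q2] := q_bounds sp.
have r0 := r_gt0 sp.
have qD0 m : 0 <= qD d m.
  apply: addr_ge0; first by rewrite mulr_ge0 ?exprn_ge0//; lra.
  by apply: divr_ge0 => //; lra.
elim: n => [|n IH] U U'.
  move=> x Ux; have [y Uy] := lim_nonempty sp U'; exists y => //.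
  apply: le_trans (I_dist (lim_subI Ux) (lim_subI Uy)) _.
  by rewrite /qD expr0 mul1r lerDl divr_ge0//; lra.
have eqD : qD d n.+1 = q * qD d n + d + q * qD d n.
  by rewrite /qD exprS; field; lra.
rewrite eqD [lim_set U](lim_pieces sp) [lim_set U'](lim_pieces sp).
have same b T T' : near_sub (q * qD d n) (pieces b (lim_set T)) (pieces b (lim_set T')).
  by apply: near_sub_pieces => //; exact: IH.
have [->|U01] := eqVneq (U 0%N) (U' 0%N).
  apply: (near_subW _ (same _ _ _)); have := mulr_ge0 (ltW q0) (qD0 n); lra.
have cross T T' : T 0%N = U 0%N -> T' 0%N = U' 0%N ->
    near_sub d (lim_set T) (lim_set T') ->
    near_sub (q * qD d n + d + q * qD d n) (pieces (U 0%N) (lim_set (tail 1 U)))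
      (pieces (U' 0%N) (lim_set (tail 1 U'))).
  rewrite [lim_set T](lim_pieces sp) [lim_set T'](lim_pieces sp) => -> -> TT'.
  by apply: near_sub_trans (same _ _ _); apply: near_sub_trans TT'; exact: same.
have opp (b b' : bool) : b != b' -> b' = ~~ b by case: b b' => [] [].
have [e|/opp e] := eqVneq (V 0%N) (U 0%N).
  by apply: (cross V V') => //; rewrite (opp _ _ V01) (opp _ _ U01) e.
by apply: (cross V' V) => //; rewrite ?(opp _ _ V01) ?(opp _ _ U01) e ?negbK.
Qed.

(** If limit sets of different first kinds could be arbitrarily close, all
    limit sets would coincide, in particular those of the two constant
    sequences. *)
Lemma separation : lim_set (fun=> true) <> lim_set (fun=> false) ->
  exists2 d, 0 < d & forall V V', near_sub d (lim_set V) (lim_set V') ->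
    near_sub d (lim_set V') (lim_set V) -> V 0%N = V' 0%N.
Proof.
move=> neq; have /andP[q0 q2] := q_bounds sp; have r0 := r_gt0 sp.
have [e e0 nearE] : exists2 e, 0 < e &
    ~ (near_sub e (lim_set (fun=> true)) (lim_set (fun=> false)) /\
       near_sub e (lim_set (fun=> false)) (lim_set (fun=> true))).
  apply: contrapT => H; apply: neq.
  have near2 e : 0 < e -> (near_sub e (lim_set (fun=> true)) (lim_set (fun=> false)) /\
       near_sub e (lim_set (fun=> false)) (lim_set (fun=> true))).
    by move=> e0; apply: contrapT => H2; apply: H; exists e.
  apply/seteqP; split; apply: near_sub_closed; try exact: lim_closed sp _.
    by move=> e /near2 [].
  by move=> e /near2 [].
have d0 : 0 < (1 - 2 * q) * (e / 2) by rewrite mulr_gt0 ?divr_gt0//; lra.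
exists ((1 - 2 * q) * (e / 2)) => // V V' VV' V'V.
apply/eqP/negPn/negP => V01; apply: nearE.
have [n nE] : exists n, (2 * q) ^+ n * (2 * r) <= e / 2.
  by apply: expr_small; rewrite ?divr_gt0//; [apply/andP; split|]; lra.
have all U U' : near_sub e (lim_set U) (lim_set U').
  have h := all_near_sub n (ltW d0) V01 VV' V'V; apply: (near_subW _ (h U U')).
  clear neq; have e3 : (1 - 2 * q) * (e / 2) / (1 - 2 * q) = e / 2 by field; lra.
  by rewrite /qD e3; lra.
by split; exact: all.
Qed.

Definition cyl_len s : R := comp s (c + r) - comp s (c - r).

(** The ratio of two difference quotients of one composition is at most this
    number, whatever the word. *)
Definition distortion : R := expR (2 * affine_error q M alpha * (2 * r) `^ alpha).

Lemma distortion_gt0 : 0 < distortion. Proof. exact: expR_gt0. Qed.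

Lemma cyl_len_gt0 s : 0 < cyl_len s.
Proof.
rewrite subr_gt0; apply: (word_map_lt sp) (I_left sp) (I_right sp) _.
have := r_gt0 sp; lra.
Qed.

Lemma cyl_dist s x y : Itv x -> Itv y -> `|comp s x - comp s y| <= cyl_len s.
Proof.
move=> Ix Iy; have l z (Iz : Itv z) : comp s (c - r) <= comp s z <= comp s (c + r).
  have := Iz; rewrite /= in_itv /= => /andP[? ?].
  by apply/andP; split; apply: (word_map_le sp) => //; [exact: I_left sp|exact: I_right sp].
have /andP[? ?] := l x Ix; have /andP[? ?] := l y Iy.
by rewrite /cyl_len ler_norml; apply/andP; split; lra.
Qed.

Lemma bounded_distortion s x y : Itv x -> Itv y ->
  logclose (2 * affine_error q M alpha * (2 * r) `^ alpha)
    ((comp s x - comp s y) * (2 * r)) (cyl_len s * (x - y)).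
Proof.
move=> Ix Iy; have Ir := I_right sp; have Il := I_left sp.
have h1 := word_slope na s Ir Ix Iy (I_dist Ix Ir) (I_dist Iy Ir).
have h2 := word_slope na s Ir Ir Il (I_dist Ir Ir) (I_dist Il Ir).
rewrite -/(cyl_len s) in h2.
have e1 : c + r - (c - r) = 2 * r by ring.
rewrite e1 in h2.
have h3 := logcloseMr (2 * r) h1.
have h4 := logclose_sym (logcloseMr (x - y) h2).
have e2 : slope s (c + r) * (x - y) * (2 * r) =
  slope s (c + r) * (2 * r) * (x - y) by ring.
rewrite e2 in h3.
by apply: le_logclose (logclose_trans h3 h4); lra.
Qed.

Lemma dist_le_cyl s x y : Itv x -> Itv y ->
  cyl_len s * `|x - y| <= distortion * (2 * r) * `|comp s x - comp s y|.
Proof.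
move=> Ix Iy; have := logclose_norm_ge (bounded_distortion s Ix Iy).
rewrite [`|cyl_len s * _|]normrM [`|_ * (2 * r)|]normrM.
rewrite (gtr0_norm (cyl_len_gt0 s)) (@gtr0_norm _ (2 * r)).
  rewrite -/distortion => h; rewrite -mulrA [2 * r * _]mulrC. exact: h.
by have := r_gt0 sp; lra.
Qed.

Lemma cyl_le_dist s x y : Itv x -> Itv y ->
  `|comp s x - comp s y| * (2 * r) <= distortion * (cyl_len s * `|x - y|).
Proof.
move=> Ix Iy; have := logclose_norm_le (bounded_distortion s Ix Iy).
rewrite [`|cyl_len s * _|]normrM [`|_ * (2 * r)|]normrM.
rewrite (gtr0_norm (cyl_len_gt0 s)) (@gtr0_norm _ (2 * r)) -/distortion//.
by have := r_gt0 sp; lra.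
Qed.

Lemma cyl_len_small s : cyl_len s <= q ^+ size s * (2 * r).
Proof.
have := word_map_contract na s (I_right sp) (I_left sp).
rewrite -/(cyl_len s) (gtr0_norm (cyl_len_gt0 s)).
have e1 : c + r - (c - r) = 2 * r by ring.
by rewrite e1 (@gtr0_norm _ (2 * r))//; have := r_gt0 sp; lra.
Qed.

(** A gap [gap] between first-level pieces, divided by the loss due to the
    distortion of a composition and by the length of the interval. *)
Definition isolation : R := gap / (distortion * (2 * r)).

Lemma isolation_gt0 : 0 < isolation.
Proof.
have := r_gt0 sp => r0.
by rewrite divr_gt0 ?(sp_gap sp)// mulr_gt0 ?distortion_gt0//; lra.
Qed.

Lemma cyl_len_cat s t : cyl_len (s ++ t) <= cyl_len s.
Proof.
have := @cyl_dist s (comp t (c + r)) (comp t (c - r)).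
rewrite -!word_map_cat -/(cyl_len (s ++ t)) (gtr0_norm (cyl_len_gt0 _)); apply.
  exact: word_map_stable na _ _ (I_right sp).
exact: word_map_stable na _ _ (I_left sp).
Qed.

(** A point of the limit set outside the cylinder of [s] is separated from it
    at the first letter where the codes differ, by the image of a first-level gap
    under the common prefix; this image is comparable with the cylinder of that
    prefix, which contains the cylinder of [s]. *)
Lemma cyl_isolated s V y u : matches V s -> lim_set V y -> Itv u ->
  `|y - comp s u| < isolation * cyl_len s ->
  exists2 y', lim_set (tail (size s) V) y' & y = comp s y'.
Proof.
move=> ms limy Iu.
(* The induction on [s] runs behind a prefix [t] shared by both codes. *)
suff H t : `|comp t y - comp t (comp s u)| < isolation * cyl_len (t ++ s) ->
    exists2 y', lim_set (tail (size s) V) y' & y = comp s y' by exact: (H [::]).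
elim: s V y t ms limy => [|k s IH] V y t /=; first by move=> _ limy _; exists y.
move=> [kk ms]; rewrite {1}(lim_pieces sp) => -[i [y1 [ki limy1 ->]]] h.
have [ik|ik] := eqVneq i k.
  subst i; have [] := IH (tail 1 V) y1 (rcons t k) ms limy1.
    by move: h; rewrite -cats1 !word_map_cat -catA.
  by rewrite tail_tail => y' limy' ->; exists y'.
exfalso.
have Iy1 := lim_subI limy1; have Iu1 := word_map_stable na s Iu.
have := sp_sep sp (etrans ki (esym kk)) ik Iy1 Iu1.
have := dist_le_cyl t (phi_stable sp i Iy1) (phi_stable sp k Iu1).
set X := `|phi i y1 - _| => h1 h2.
have r0 := r_gt0 sp; have K0 := distortion_gt0.
have c0 := cyl_len_gt0 t.
have h3 : cyl_len t * gap <= distortion * (2 * r) *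
    `|comp t (phi i y1) - comp t (phi k (comp s u))|.
  by apply: le_trans h1; rewrite ler_pM2l.
have h4 : cyl_len t * isolation <= `|comp t (phi i y1) - comp t (phi k (comp s u))|.
  by rewrite /isolation mulrA ler_pdivrMr 1?[leRHS]mulrC// mulr_gt0//; lra.
have := le_lt_trans h4 h; rewrite mulrC ltr_pM2l ?isolation_gt0//.
by rewrite ltNge cyl_len_cat.
Qed.

End SeparationIsolation.

(** * Rigidity of near isometries between limit sets *)

Section Rigidity.
Context {R : realType} (c r : R) {L : finType} (kind : L -> bool)
  (phi der : L -> R -> R) (q M alpha gap : R).
Context (sp : symmetric_pair c r kind phi der q M alpha gap).

Local Notation Itv := (`[c - r, c + r]%classic : set R).
Local Notation comp := (word_map phi).
Local Notation lim_set := (lim_set c r kind phi).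
Local Notation cyl_len := (cyl_len c r phi).
Local Notation distortion := (distortion r q M alpha).

Let na : nearly_affine Itv phi der q M alpha := sp_na sp.

(** A relation rather than a map: the relation is kept unchanged, in the
    coordinates of the whole interval, while [s] grows. *)
Definition matching (P : R -> R -> Prop) s V V' : Prop :=
  (forall x, lim_set V x -> exists2 x', lim_set V' x' & P (comp s x) (comp s x')) /\
  (forall x', lim_set V' x' -> exists2 x, lim_set V x & P (comp s x) (comp s x')).

Definition near_isometry (e : R) (P : R -> R -> Prop) : Prop :=
  forall y1 y1' y2 y2', P y1 y1' -> P y2 y2' ->
    `|(y1' - y2') - (y1 - y2)| <= e * `|y1 - y2|.

(** If every point moves to the right by [t], reflect the image of a point [x]
    close to the supremum of the first set: its partner, reflected back, lies beyond
    [x + 2 * t]. *)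
Lemma no_drift V V' t : 0 < t ->
  (forall x, lim_set V x -> exists2 x', lim_set V' x' & x + t <= x') ->
  (forall x', lim_set V' x' -> exists2 x, lim_set V x & x + t <= x') -> False.
Proof.
move=> t0 VV' V'V.
have supV : has_sup (lim_set V).
  split; first exact: lim_nonempty sp V.
  by exists (c + r) => x /lim_subI; rewrite /= in_itv /= => /andP[].
have [x Vx xsup] := sup_adherent t0 supV.
have [x' V'x' xx'] := VV' x Vx.
have [x2 Vx2 xx2] := V'V _ (lim_sym sp V'x').
have := ub_le_sup (proj2 supV) (lim_sym sp Vx2).
lra.
Qed.

(** The displacements [comp s x' - comp s x] differ from one another by at
    most [e * cyl_len s].  If one of them exceeded twice that, all of them would
    have the same sign and be bounded away from 0, against [no_drift].  Bounded
    distortion then transfers the estimate to the coordinates of [x]. *)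
Lemma displacement_small e P s V V' : 0 <= e -> near_isometry e P ->
    matching P s V V' -> forall x x', lim_set V x -> lim_set V' x' ->
  P (comp s x) (comp s x') -> `|x' - x| <= 4 * r * distortion * e.
Proof.
move=> e0 isoP [PV PV'] x x' Vx Vx' Pxx'.
have len0 := cyl_len_gt0 sp s.
have elen0 : 0 <= e * cyl_len s by rewrite mulr_ge0// ltW.
have bound y y' : lim_set V y -> lim_set V' y' -> P (comp s y) (comp s y') ->
    `|(comp s x' - comp s y') - (comp s x - comp s y)| <= e * cyl_len s.
  move=> Vy Vy' Pyy'; apply: le_trans (isoP _ _ _ _ Pxx' Pyy') _.
  apply: ler_wpM2l => //; exact: (cyl_dist sp s (lim_subI Vx) (lim_subI Vy)).
have expand y z t : Itv y -> Itv z -> 0 < t -> t <= comp s z - comp s y -> y + t <= z.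
  move=> Iy Iz t0 tle.
  have yz : y < z.
    by rewrite ltNge; apply/negP => /(word_map_le sp s Iz Iy) h;
    have := lt_le_trans t0 tle; rewrite subr_gt0 ltNge h.
  have := word_map_contract na s Iz Iy.
  have /andP[q0 q1] := na_q na.
  rewrite [`|z - y|]gtr0_norm ?subr_gt0// => h.
  have h2 : q ^+ size s * (z - y) <= z - y.
    by rewrite ler_piMl ?subr_ge0 ?(ltW yz)// exprn_ile1// ltW.
  by have := le_trans (ler_norm _) (le_trans h h2); lra.
suff XX : `|comp s x' - comp s x| <= 2 * e * cyl_len s.
  have := dist_le_cyl sp s (lim_subI Vx') (lim_subI Vx).
  move=> h; rewrite -(ler_pM2l len0); apply: le_trans h _.
  have -> : cyl_len s * (4 * r * distortion * e) =
      distortion * (2 * r) * (2 * e * cyl_len s) by ring.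
  rewrite ler_wpM2l// mulr_ge0 ?ltW ?distortion_gt0//.
  by have := r_gt0 sp; lra.
rewrite ler_norml; apply/andP; split; rewrite leNgt; apply/negP => XX.
  set t := comp s x - comp s x' - e * cyl_len s.
  have t0 : 0 < t by rewrite /t; lra.
  have sepn y y' : lim_set V y -> lim_set V' y' ->
      P (comp s y) (comp s y') -> y' + t <= y.
    move=> Vy Vy' Pyy'; apply: expand => //; [exact: lim_subI Vy'|exact: lim_subI Vy|].
    by have := bound y y' Vy Vy' Pyy'; rewrite ler_norml /t => /andP[? ?]; lra.
  apply: (@no_drift V' V t t0).
    by move=> y' Vy'; have [y Vy Pyy'] := PV' y' Vy'; exists y => //; exact: sepn.
  by move=> y Vy; have [y' Vy' Pyy'] := PV y Vy; exists y' => //; exact: sepn.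
set t := comp s x' - comp s x - e * cyl_len s.
have t0 : 0 < t by rewrite /t; lra.
have sepn y y' : lim_set V y -> lim_set V' y' ->
    P (comp s y) (comp s y') -> y + t <= y'.
  move=> Vy Vy' Pyy'; apply: expand => //; [exact: lim_subI Vy|exact: lim_subI Vy'|].
  by have := bound y y' Vy Vy' Pyy'; rewrite ler_norml /t => /andP[? ?]; lra.
apply: (@no_drift V V' t t0).
  by move=> y Vy; have [y' Vy' Pyy'] := PV y Vy; exists y' => //; exact: sepn.
by move=> y' Vy'; have [y Vy Pyy'] := PV' y' Vy'; exists y => //; exact: sepn.
Qed.

(** Small displacements make the two limit sets close, hence of the same first
    kind by [separation]; they are also smaller than the gaps between
    pieces, so that the relation matches pieces of equal letters.  The bound on
    the displacements does not depend on [s], which lets the induction go on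
    along [rcons s i]. *)
Lemma rigidity : lim_set (fun=> true) <> lim_set (fun=> false) ->
  exists2 e, 0 < e & forall P s V V', near_isometry e P -> matching P s V V' ->
    V =1 V'.
Proof.
move=> neq; have [d d0 sepd] := separation sp neq.
have r0 := r_gt0 sp; have gap0 := sp_gap sp.
have K0 := distortion_gt0 r q M alpha.
have C0 : 0 < 4 * r * distortion by rewrite !mulr_gt0.
set m := Num.min d (gap / 2).
have m0 : 0 < m by rewrite lt_min d0 divr_gt0.
exists (m / (4 * r * distortion)); first by rewrite divr_gt0.
set e := m / _; have e0 : 0 <= e by rewrite divr_ge0// ltW.
have Ce : 4 * r * distortion * e = m by rewrite /e mulrC divfK// gt_eqF.
move=> P s V V' isoP mat n; elim: n s V V' mat => [|n IH] s V V' mat.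
all: have disp := displacement_small e0 isoP mat.
all: rewrite Ce in disp; have [PV PV'] := mat.
all: have V0 : V 0%N = V' 0%N.
1,3: apply: sepd => x Vx;
  [have [x' Vx' Pxx'] := PV x Vx|have [x' Vx' Pxx'] := PV' x Vx];
  exists x' => //; [rewrite distrC|]; apply: (le_trans (disp _ _ _ _ Pxx')) => //;
  by rewrite ge_min lexx.
- exact: V0.
have [i ki] := sp_kind sp (V 0%N).
have mgap : m < gap by rewrite (@le_lt_trans _ _ (gap / 2)) ?ge_min ?lexx ?orbT//; lra.
apply: (IH (rcons s i) (tail 1 V) (tail 1 V')).
rewrite /matching -cats1; split=> y Vy.
  have Viy : lim_set V (phi i y) by rewrite (lim_pieces sp); exists i, y.
  have [x' Vx' Pxx'] := PV _ Viy.
  have dx := disp _ _ Viy Vx' Pxx'.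
  have := Vx'; rewrite (lim_pieces sp) => -[j [y' [kj Vy' xE]]].
  subst x'; have [ij|ij] := eqVneq i j.
    by subst j; exists y' => //; rewrite !word_map_cat.
  have := sp_sep sp _ ij (lim_subI Vy) (lim_subI Vy').
  by rewrite ki kj V0 distrC => /(_ erefl); lra.
have Viy : lim_set V' (phi i y) by rewrite (lim_pieces sp); exists i, y; rewrite -V0.
have [x' Vx' Pxx'] := PV' _ Viy.
have dx := disp _ _ Vx' Viy Pxx'.
have := Vx'; rewrite (lim_pieces sp) => -[j [y' [kj Vy' xE]]].
subst x'; have [ij|ij] := eqVneq i j.
  by subst j; exists y' => //; rewrite !word_map_cat.
have := sp_sep sp _ ij (lim_subI Vy) (lim_subI Vy').
by rewrite ki kj => /(_ erefl); lra.
Qed.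

End Rigidity.

(** * Pigeonholes, and linearization at a fixed point *)

Lemma pigeonhole_nat (T : finType) (f : nat -> T) :
  exists i j, (i < j)%N /\ f i = f j.
Proof.
apply: contrapT => H.
have inj : injective (fun i : 'I_#|T|.+1 => f i).
  move=> i j fij; apply/val_inj => /=.
  by have [ij|ji|//] := ltngtP i j; exfalso; apply: H; [exists i, j|exists j, i].
by have := leq_card _ inj; rewrite card_ord ltnn.
Qed.

(** Sort the numbers [ln (b m) / ln lam] by their residues modulo 1, with bins
    of length [1 / J.+1], which is at most [e] once multiplied by [- ln lam]. *)
Lemma scale_bins (R : realType) (b : nat -> R) (lam e : R) :
    0 < lam < 1 -> 0 < e -> (forall m, 0 < b m <= 1) ->
    (forall m n, (m <= n)%N -> b n <= b m) ->
  exists J (N : nat -> 'I_J.+1), forall m n, (m <= n)%N -> N m = N n ->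
    exists l, logclose e (lam ^+ l * b m) (b n).
Proof.
move=> lam01 e0 b01 bdec.
have /andP[lam0 _] := lam01; have lnlam := ln_lt0 lam01.
have lnlamN : 0 < - ln lam by rewrite oppr_gt0.
set J := Num.truncn (- ln lam / e); exists J.
have JE : - ln lam < e * J.+1%:R.
  have /andP[_] := truncn_itv (divr_ge0 (ltW lnlamN) (ltW e0)).
  by rewrite ltr_pdivrMr// mulrC.
set x := fun m => J.+1%:R * (ln (b m) / ln lam).
have x0 m : 0 <= x m.
  have /andP[b0 b1] := b01 m.
  rewrite mulr_ge0// -mulrNN -invrN mulr_ge0 ?invr_ge0 ?(ltW lnlamN)//.
  by rewrite oppr_ge0 ln_le0.
have xmono m n : (m <= n)%N -> x m <= x n.
  move=> mn; rewrite ler_wpM2l// ler_ndivrMr//  divfK ?lt_eqF//.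
  have /andP[b0 b1] := b01 m; have /andP[b0' b1'] := b01 n.
  by rewrite ler_ln ?posrE// bdec.
exists (fun m => inord (Num.truncn (x m) %% J.+1)) => m n mn.
move=> /(congr1 val) /=; rewrite !inordK ?ltn_pmod// => modE.
set A := Num.truncn (x m); set B := Num.truncn (x n); rewrite -/A -/B in modE.
have AB : (A <= B)%N by apply: le_truncn; exact: xmono.
exists (B %/ J.+1 - A %/ J.+1)%N; set l := (_ - _)%N.
have BE : B = (A + l * J.+1)%N.
  rewrite mulnBl {1}(divn_eq B J.+1) {1}(divn_eq A J.+1) modE addnAC subnKC//.
  by rewrite leq_mul2r leq_div2r// orbT.
have /andP[b0 b1] := b01 m; have /andP[b0' b1'] := b01 n.
apply: logclose_ratio; rewrite ?mulr_gt0 ?exprn_gt0//.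
rewrite lnM ?posrE ?exprn_gt0// lnXn// -mulr_natl.
have /andP[A1 A2] := truncn_itv (x0 m); have /andP[B1 B2] := truncn_itv (x0 n).
rewrite -/A in A1 A2; rewrite -/B in B1 B2.
have BR : B%:R = A%:R + l%:R * J.+1%:R :> R by rewrite BE natrD natrM.
have AS : A.+1%:R = A%:R + 1 :> R by rewrite -natr1.
have BS : B.+1%:R = B%:R + 1 :> R by rewrite -natr1.
have J0 : 0 < J.+1%:R :> R by rewrite ltr0n.
have xb k : ln (b k) = x k * ln lam / J.+1%:R.
  by rewrite /x; field; rewrite gt_eqF//= lt_eqF.
rewrite !xb.
have -> : l%:R * ln lam + x m * ln lam / J.+1%:R - x n * ln lam / J.+1%:R =
    (x n - x m - l%:R * J.+1%:R) * (- ln lam / J.+1%:R).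
  by field; rewrite gt_eqF.
rewrite normrM (@gtr0_norm _ (- ln lam / _)) ?divr_gt0//.
have le1 : `|x n - x m - l%:R * J.+1%:R| <= 1.
  by rewrite ler_norml; apply/andP; split; lra.
apply: le_trans (_ : 1 * (- ln lam / J.+1%:R) <= _).
  by rewrite ler_wpM2r// divr_ge0 ?ltW.
by rewrite mul1r ler_pdivrMr// ltW.
Qed.

(** Self-similarity of [C] at a point.  In [lf_linear] the size [eta] of the
    neighbourhood does not depend on the number [l] of iterates, so that [h ^ l]
    can be compared with a homothety at every scale. *)
Record linear_fixpoint {R : realType} (C : set R) (h : R -> R) (z lam : R) : Prop :=
  LinearFixpoint {
  lf_in : C z;
  lf_fix : h z = z;
  lf_stable : forall x, C x -> C (h x);
  lf_lam : 0 < lam < 1;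
  lf_linear : forall e, 0 < e -> exists2 eta, 0 < eta & forall l x y, C x -> C y ->
    `|x - z| <= eta -> `|y - z| <= eta ->
    logclose e (iter l h x - iter l h y) (lam ^+ l * (x - y));
  lf_preimage : forall eta, 0 < eta -> exists2 eta', 0 < eta' &
    forall y, C y -> `|y - z| <= eta' ->
      exists x, [/\ C x, `|x - z| <= eta & h x = y] }.

Section LinearFixpointTheory.
Context {R : realType} {C : set R} {h : R -> R} {z lam : R}.
Context (lf : linear_fixpoint C h z lam).

Lemma lf_iter_fix l : iter l h z = z.
Proof. by elim: l => //= l ->; exact: lf_fix lf. Qed.

Lemma lf_iter_stable l x : C x -> C (iter l h x).
Proof. by move=> Cx; elim: l => //= l; exact: lf_stable lf _. Qed.

(** Preimages are taken one at a time; the linear behaviour of the iterates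
    already undone shows that each of them is still close enough to the fixed point
    for the next step. *)
Lemma lf_iter_preimage eta : 0 < eta -> exists2 eta', 0 < eta' &
  forall l y, C y -> `|y - z| <= eta' * lam ^+ l ->
    exists x, [/\ C x, `|x - z| <= eta & iter l h x = y].
Proof.
move=> eta0; have /andP[lam0 lam1] := lf_lam lf.
have [ea ea0 lin] := lf_linear lf ltr01.
have m0 : 0 < Num.min eta ea by rewrite lt_min eta0.
have [e' e'0 pre] := lf_preimage lf m0.
have E0 := expR_gt0 (1 : R).
have mm0 : 0 < Num.min e' (Num.min eta ea) by rewrite lt_min e'0.
exists (Num.min e' (Num.min eta ea) / expR 1); first by rewrite divr_gt0.
move=> l y Cy yz.
suff H j : (j <= l)%N ->
    exists x, [/\ C x, `|x - z| <= Num.min eta ea & iter j h x = y].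
  have [x [Cx xz xy]] := H l (leqnn l); exists x; split=> //.
  by move: xz; rewrite le_min => /andP[].
elim: j => [|j IH] jl.
  exists y; split=> //; apply: le_trans yz _.
  apply: (@le_trans _ _ (Num.min e' (Num.min eta ea) / expR 1)).
    by rewrite ler_piMr ?exprn_ile1 ?(ltW lam0) ?(ltW lam1)// divr_ge0 ?ltW.
  rewrite ler_pdivrMr// (@le_trans _ _ (Num.min eta ea))//.
    by rewrite ge_min lexx orbT.
  by rewrite ler_peMr ?(ltW m0)// -expR0 ler_expR.
have [x [Cx xz xy]] := IH (ltnW jl).
have := lin j x z Cx (lf_in lf).
rewrite subrr normr0 (ltW ea0) => /(_ _ isT).
move: (xz); rewrite le_min => /andP[_ xea] /(_ xea).
move=> /logclose_norm_ge; rewrite lf_iter_fix xy normrM.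
rewrite (@gtr0_norm _ (lam ^+ j)) ?exprn_gt0//.
move=> h1.
have lj0 : 0 < lam ^+ j by rewrite exprn_gt0.
have h2 : lam ^+ j * `|x - z| <= Num.min e' (Num.min eta ea) * lam ^+ l.
  apply: le_trans h1 _.
  rewrite -(ler_pM2l E0) in yz; apply: le_trans yz _.
  by rewrite mulrA [expR 1 * _]mulrC divfK ?gt_eqF.
have h3 : lam ^+ l <= lam ^+ j by rewrite ler_wiXn2l ?(ltW lam0) ?(ltW lam1)// ltnW.
have h4 : `|x - z| <= Num.min e' (Num.min eta ea).
  rewrite -(ler_pM2l lj0); apply: le_trans h2 _.
  by rewrite mulrC ler_pM2r.
have h5 : Num.min e' (Num.min eta ea) <= e' by rewrite ge_min lexx.
have [x' [Cx' x'z x'x]] := pre x Cx (le_trans h4 h5).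
by exists x'; split=> //; rewrite iterSr x'x.
Qed.

End LinearFixpointTheory.

(** * Location of points along a coded orbit *)

Section Coding.
Context {R : realType} (c r : R) {L : finType} (kind : L -> bool)
  (phi der : L -> R -> R) (q M alpha gap : R).
Context (sp : symmetric_pair c r kind phi der q M alpha gap).
Context (V : nat -> bool) (z : R).

Local Notation lim_set := (lim_set c r kind phi).

(** Dependent choice along [lim_pieces]. *)
Lemma coding : lim_set V z -> exists (w : nat -> L) (orb : nat -> R),
  [/\ orb 0%N = z, forall n, kind (w n) = V n,
    forall n, lim_set (tail n V) (orb n) & forall n, orb n = phi (w n) (orb n.+1)].
Proof.
move=> Vz.
have next (p : nat * R) : exists p' : L * R, lim_set (tail p.1 V) p.2 ->
    [/\ kind p'.1 = V p.1, lim_set (tail p.1.+1 V) p'.2 & p.2 = phi p'.1 p'.2].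
  have [lim|nlim] := pselect (lim_set (tail p.1 V) p.2).
    have := lim; rewrite (lim_pieces sp) tail_tail addn1 => -[i [y [ki Vy yE]]].
    by exists (i, y) => _; split=> //; rewrite ki /tail addn0.
  by have [i _] := sp_kind sp true; exists (i, z) => /nlim.
have /choice [g gP] := next.
pose orb := fix orb n := if n is m.+1 then (g (m, orb m)).2 else z.
have orbV n : lim_set (tail n V) (orb n).
  by elim: n => [//|n IH]; have [] := gP (n, orb n) IH.
exists (fun n => (g (n, orb n)).1), orb.
by split=> // n; have [] := gP (n, orb n) (orbV n).
Qed.

End Coding.

Section MatchingScales.
Context {R : realType} (c r : R) {L : finType} (kind : L -> bool)
  (phi der : L -> R -> R) (q M alpha gap : R).
Context (sp : symmetric_pair c r kind phi der q M alpha gap).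
Context (V : nat -> bool) (z : R) (w : nat -> L) (orb : nat -> R).

Local Notation Itv := (`[c - r, c + r]%classic : set R).
Local Notation comp := (word_map phi).
Local Notation slope := (word_deriv phi der).
Local Notation lim_set := (lim_set c r kind phi).
Local Notation matches := (matches kind).
Local Notation cyl_len := (cyl_len c r phi).
Local Notation isolation := (isolation r q M alpha gap).

Let na : nearly_affine Itv phi der q M alpha := sp_na sp.

Context (orb0 : orb 0%N = z) (wV : forall n, kind (w n) = V n)
  (orbV : forall n, lim_set (tail n V) (orb n))
  (orbS : forall n, orb n = phi (w n) (orb n.+1)).

Definition segment m k : seq L := map w (iota m k).

Lemma size_seg m k : size (segment m k) = k.
Proof. by rewrite size_map size_iota. Qed.

Lemma seg_cat m k l : segment m (k + l) = segment m k ++ segment (m + k) l.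
Proof. by rewrite /segment iotaD map_cat. Qed.

Lemma seg_matches m k : matches (tail m V) (segment m k).
Proof.
elim: k m => //= k IH m; split; first by rewrite wV /tail addn0.
by rewrite tail_tail addn1; exact: IH.
Qed.

Lemma orbI n : Itv (orb n). Proof. exact: lim_subI (orbV n). Qed.

Lemma orb_seg m k : orb m = comp (segment m k) (orb (m + k)).
Proof.
elim: k m => [|k IH] m /=; first by rewrite addn0.
by rewrite orbS (IH m.+1) addSnnS.
Qed.

Definition prefix_slope m : R := slope (segment 0 m) (orb m).

Lemma prefix_slope_gt0 m : 0 < prefix_slope m.
Proof. exact: word_deriv_gt0 sp _ _ (orbI m). Qed.

Lemma prefix_slopeS m : prefix_slope m.+1 = prefix_slope m * der (w m) (orb m.+1).
Proof.
by rewrite /prefix_slope -addn1 seg_cat word_deriv_cat /= add0n mulr1 addn1 -orbS.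
Qed.

Lemma prefix_slope_dec m n : (m <= n)%N -> prefix_slope n <= prefix_slope m.
Proof.
elim: n => [|n IH]; first by rewrite leqn0 => /eqP ->.
rewrite leq_eqVlt => /predU1P[-> //|/IH h]; apply: le_trans h.
rewrite prefix_slopeS ler_piMr ?(ltW (prefix_slope_gt0 _))//.
by have /andP[_ /ltW] := sp_der sp (w n) (orbI n.+1).
Qed.

Lemma prefix_slope_le1 m : prefix_slope m <= 1.
Proof. exact: prefix_slope_dec (leq0n m). Qed.

Lemma cyl_len_prefix_small eta : 0 < eta ->
  exists N, forall m, (N <= m)%N -> cyl_len (segment 0 m) <= eta.
Proof.
move=> eta0; have /andP[q0 q1] := na_q na; have r0 := r_gt0 sp.
have [N NE] : exists N, q ^+ N * (2 * r) <= eta.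
  by apply: expr_small => //; [rewrite (ltW q0)|lra].
exists N => m Nm; apply: le_trans (cyl_len_small sp _) (le_trans _ NE).
rewrite size_seg ler_wpM2r//; first lra.
by rewrite ler_wiXn2l ?(ltW q0) ?(ltW q1).
Qed.

(** The suffix [v] brings the whole interval into a set of diameter
    [q ^+ s0 * (2 * r)], on which all prefixes are affine up to a factor close
    to 1. *)
Lemma prefix_affine e : 0 < e -> exists s0, forall m (v : seq L) y1 y2,
  v = segment m s0 -> Itv y1 -> Itv y2 ->
  logclose e (comp (segment 0 m) (comp v y1) - comp (segment 0 m) (comp v y2))
    (prefix_slope m * (comp v y1 - comp v y2)).
Proof.
move=> e0; have /andP[q0 q1] := na_q na; have r0 := r_gt0 sp.
have A0 := affine_error_ge0 na; set A := affine_error q M alpha in A0 *.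
have [s0 s0E] : exists s0, (q `^ alpha) ^+ s0 * (A * (2 * r) `^ alpha) <= e.
  by apply: expr_small => //; [exact: powR_q_lt1 na|rewrite mulr_ge0 ?powR_ge0].
exists s0 => m v y1 y2 vE Iy1 Iy2.
have near y : Itv y -> `|comp v y - orb m| <= cyl_len v.
  by move=> Iy; rewrite (orb_seg m s0) -vE; exact: (cyl_dist sp v Iy (orbI (m + s0))).
have stable y : Itv y -> Itv (comp v y) by move=> Iy; exact: (word_map_stable na v Iy).
have := word_slope na (segment 0 m) (orbI m) (stable _ Iy1) (stable _ Iy2)
  (near _ Iy1) (near _ Iy2).
apply: le_logclose; apply: le_trans s0E.
rewrite -/A mulrCA ler_wpM2l//.
have len : cyl_len v <= q ^+ s0 * (2 * r).
  by have := cyl_len_small sp v; rewrite vE size_seg.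
have len0 := ltW (cyl_len_gt0 sp v).
apply: le_trans (_ : (q ^+ s0 * (2 * r)) `^ alpha <= _).
  apply: ge0_ler_powR; rewrite ?nnegrE//; first exact: ltW (na_alpha na).
  exact: le_trans len.
rewrite powRM ?exprn_ge0 ?(ltW q0)//; last by lra.
by rewrite -powR_mulrn ?(ltW q0)// powRAC powR_mulrn ?powR_ge0.
Qed.

(** If [X - z] is what the affine approximation of the prefix predicts for a
    point of the cylinder, up to errors small compared with [isolation], then [X] is
    closer to the cylinder than the other points of the limit set can be.  The
    reference point [comp v a] may differ slightly from [orb m]: two positions
    that are matched have close but distinct orbit points. *)
Lemma locate_in_cylinder e m v s0 x a X :
    0 < e -> e <= 1 / 8 -> 20 * e <= isolation ->
    (forall y1 y2, Itv y1 -> Itv y2 ->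
      logclose e (comp (segment 0 m) (comp v y1) - comp (segment 0 m) (comp v y2))
        (prefix_slope m * (comp v y1 - comp v y2))) ->
    v = segment m s0 -> Itv x -> Itv a ->
    `|orb m - comp v a| <= e * cyl_len v ->
    lim_set V X ->
    logclose (3 * e) (X - z) (prefix_slope m * (comp v x - comp v a)) ->
  exists2 x', lim_set (tail (m + s0) V) x' & X = comp (segment 0 m) (comp v x').
Proof.
move=> e0 e8 eiso aff vE Ix Ia orba VX Xz.
have b0 := prefix_slope_gt0 m; set b := prefix_slope m in b0 aff Xz *.
have len0 := cyl_len_gt0 sp v.
have sE : segment 0 (m + s0) = segment 0 m ++ v by rewrite seg_cat add0n -vE.
have orbE : orb m = comp v (orb (m + s0)) by rewrite (orb_seg m s0) vE.
have zE : z = comp (segment 0 m) (orb m) by rewrite -orb0 {1}(orb_seg 0 m).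
suff close : `|X - comp (segment 0 (m + s0)) x| <
    isolation * cyl_len (segment 0 (m + s0)).
  have [x' Vx' XE] := cyl_isolated sp (seg_matches 0 (m + s0)) VX Ix close.
  rewrite size_seg tail_tail add0n in Vx'.
  by exists x' => //; rewrite XE sE word_map_cat.
have e2 : e <= 1 / 2 by lra. have e32 : 3 * e <= 1 / 2 by lra.
have lenE : b * cyl_len v <= 2 * cyl_len (segment 0 (m + s0)).
  have := logclose_dist e2 (aff _ _ (I_right sp) (I_left sp)).
  rewrite -!word_map_cat -sE -/(cyl_len (segment 0 (m + s0))) -/(cyl_len v).
  rewrite (gtr0_norm (mulr_gt0 b0 len0)).
  rewrite ler_norml => /andP[h _].
  by have := mulr_gt0 b0 len0; nra.
have d1 : `|X - z - b * (comp v x - comp v a)| <= 6 * e * (b * cyl_len v).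
  apply: le_trans (logclose_dist e32 Xz) _; rewrite mulrA -[2 * 3]natrM.
  rewrite ler_wpM2l//; first by rewrite mulr_ge0// ltW.
  by rewrite normrM (gtr0_norm b0) ler_pM2l//; exact: (cyl_dist sp v Ix Ia).
have d2 : `|comp (segment 0 (m + s0)) x - z - b * (comp v x - orb m)| <=
    2 * e * (b * cyl_len v).
  rewrite {1}zE sE word_map_cat orbE.
  apply: le_trans (logclose_dist e2 (aff _ _ Ix (orbI (m + s0)))) _.
  rewrite ler_wpM2l//; first by rewrite mulr_ge0// ltW.
  rewrite normrM (gtr0_norm b0) ler_pM2l//.
  exact: (cyl_dist sp v Ix (orbI (m + s0))).
have d3 : `|b * (orb m - comp v a)| <= e * (b * cyl_len v).
  by rewrite normrM (gtr0_norm b0) mulrCA ler_pM2l.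
have -> : X - comp (segment 0 (m + s0)) x = (X - z - b * (comp v x - comp v a))
    - (comp (segment 0 (m + s0)) x - z - b * (comp v x - orb m))
    + b * (orb m - comp v a).
  by ring.
have clen0 := cyl_len_gt0 sp (segment 0 (m + s0)).
apply: le_lt_trans (_ : 9 * e * (b * cyl_len v) < _).
  apply: le_trans (ler_normD _ _) _; apply: le_trans (lerD (ler_normB _ _) d3) _.
  by lra.
nra.
Qed.

End MatchingScales.

(** * Recurrence of tails *)

Section Recurrence.
Context {R : realType} (c r : R) {L : finType} (kind : L -> bool)
  (phi der : L -> R -> R) (q M alpha gap : R).
Context (sp : symmetric_pair c r kind phi der q M alpha gap).
Context (V : nat -> bool) (h : R -> R) (z lam : R).

Local Notation Itv := (`[c - r, c + r]%classic : set R).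
Local Notation comp := (word_map phi).
Local Notation lim_set := (lim_set c r kind phi).
Local Notation cyl_len := (cyl_len c r phi).
Local Notation distortion := (distortion r q M alpha).
Local Notation isolation := (isolation r q M alpha gap).

Let na : nearly_affine Itv phi der q M alpha := sp_na sp.

(** The pigeonhole principle is applied to the letters of a long window and to
    the scale of the prefix derivative modulo [lam].  For two positions [m] and [n]
    in the same class, the iterate [h ^ l] with [lam ^+ l] close to the ratio of
    the prefix derivatives matches the cylinder of rank [m + s0] with the one of
    rank [n + s0], and [rigidity] concludes. *)
Theorem tail_recurrence :
  lim_set (fun=> true) <> lim_set (fun=> false) ->
  linear_fixpoint (lim_set V) h z lam ->
  exists m n, (m < n)%N /\ tail m V =1 tail n V.
Proof.
move=> neq lf.
have [w [orb [orb0 wV orbV orbS]]] := coding sp (lf_in lf).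
pose seg := segment w; pose b := prefix_slope phi der w orb.
have r0 := r_gt0 sp; have /andP[q0 q1] := na_q na.
have /andP[lam0 lam1] := lf_lam lf.
have K0 := distortion_gt0 r q M alpha; have iso0 := isolation_gt0 sp.
have [e1 e10 rigid] := rigidity sp neq.
have Iorb n : Itv (orb n) := lim_subI (orbV n).
have b0 m : 0 < b m by exact: (prefix_slope_gt0 sp w orbV m).
have orbE m k : orb m = comp (seg m k) (orb (m + k)%N) by exact: orb_seg.
(* A near isometry accumulates four errors, each doubled by [logclose_dist];
   the last bound is the one of [locate_in_cylinder]. *)
pose e := Num.min (1 / 8) (Num.min (e1 / 8) (isolation / 20)).
have e0 : 0 < e by rewrite !lt_min; apply/and3P; split; lra.
have e8 : e <= 1 / 8 by rewrite ge_min lexx.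
have ee1 : 8 * e <= e1.
  by rewrite mulrC -ler_pdivlMr// !ge_min lexx orbT.
have eiso : 20 * e <= isolation.
  by rewrite mulrC -ler_pdivlMr// !ge_min lexx !orbT.
clearbody e.
have [s0 aff] := prefix_affine sp orbV orbS e0.
have [s1 s1E] : exists s1, q ^+ s1 * distortion <= e.
  by apply: expr_small => //; [rewrite (ltW q0)|exact: ltW].
have [eta eta0 lin] := lf_linear lf e0.
have [eta' eta'0 pre] := lf_iter_preimage lf eta0.
have [N0 len_small] := @cyl_len_prefix_small _ _ _ _ _ _ _ _ _ _ _ sp w
  (Num.min eta (eta' / 8)) ltac:(by rewrite lt_min eta0 divr_gt0).
have [J [bin binP]] := scale_bins (lf_lam lf) e0
  (fun m => introT andP (conj (b0 m) (prefix_slope_le1 sp orbV orbS m)))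
  (prefix_slope_dec sp orbV orbS).
have [i [j [ij E]]] := pigeonhole_nat (fun k => (bin (N0 + k)%N,
  [tuple w (N0 + k + t)%N | t < s0 + s1])).
move: (congr1 fst E) (congr1 snd E) => /= {E}.
set m := (N0 + i)%N; set n := (N0 + j)%N => binE segE.
have mn : (m < n)%N by rewrite ltn_add2l.
have [l blb] := binP m n (ltnW mn) binE; rewrite -!/(b _) in blb.
have wE t : (t < s0 + s1)%N -> w (m + t)%N = w (n + t)%N.
  move=> ts; have := congr1 (fun T => tnth T (Ordinal ts)) segE.
  by rewrite !tnth_mktuple.
have segmn k t : (k + t <= s0 + s1)%N -> seg (m + k)%N t = seg (n + k)%N t.
  move=> kt; rewrite /seg /segment (iotaDl m k) (iotaDl n k) -!map_comp.
  apply/eq_in_map => u; rewrite mem_iota => /andP[_ ut] /=.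
  by apply: wE; exact: leq_trans ut kt.
pose v := seg m s0.
have vm : v = seg m s0 by [].
have vn : v = seg n s0.
  by have := @segmn 0%N s0; rewrite !addn0; apply; rewrite leq_addr.
clearbody v.
exists (m + s0)%N, (n + s0)%N; split; first by rewrite ltn_add2r.
have len0 := cyl_len_gt0 sp v.
(* The two orbit points share [s0 + s1] letters, hence are close at the scale
   of the cylinder of the first [s0] ones. *)
have orbmn : `|orb m - orb n| <= e * cyl_len v.
  rewrite (orbE m s0) (orbE n s0) -vm -vn.
  have := cyl_le_dist sp v (Iorb (m + s0)%N) (Iorb (n + s0)%N).
  have : `|orb (m + s0)%N - orb (n + s0)%N| <= q ^+ s1 * (2 * r).
    rewrite (orbE _ s1) (orbE (n + s0)%N s1) (segmn _ _ (leqnn _)).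
    apply: le_trans (word_map_contract na _ (Iorb _) (Iorb _)) _.
    rewrite size_map size_iota ler_wpM2l ?exprn_ge0 ?(ltW q0)//.
    exact: (I_dist (Iorb _) (Iorb _)).
  set X := `|comp _ _ - _|; set Y := `|_ - _| => h1 h2.
  have r20 : 0 < 2 * r by lra.
  rewrite -(ler_pM2r r20); apply: le_trans h2 _.
  have h3 : distortion * (cyl_len v * Y) <=
      distortion * (cyl_len v * (q ^+ s1 * (2 * r))).
    by rewrite ler_pM2l// ler_pM2l.
  apply: le_trans h3 _.
  have -> : distortion * (cyl_len v * (q ^+ s1 * (2 * r))) =
     q ^+ s1 * distortion * (cyl_len v * (2 * r)) by ring.
  by rewrite -[leRHS]mulrA ler_pM2r// mulr_gt0.
have affm := aff m v _ _ vm; have affn := aff n v _ _ vn; rewrite -!/(b _) in affm affn.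
rewrite -/seg in affm affn.
have locm := locate_in_cylinder sp orb0 wV orbV orbS e0 e8 eiso affm vm.
have locn := locate_in_cylinder sp orb0 wV orbV orbS e0 e8 eiso affn vn.
have zE k : z = comp (seg 0%N k) (orb k) by rewrite -orb0 (orbE 0%N k).
have sE k : seg 0%N (k + s0)%N = seg 0%N k ++ seg k s0 by rewrite /seg seg_cat add0n.
have lenm : cyl_len (seg 0%N (m + s0)%N) <= Num.min eta (eta' / 8).
  by apply: len_small; rewrite -addnA leq_addr.
have [lenm1 lenm2] : cyl_len (seg 0%N (m + s0)%N) <= eta /\
    cyl_len (seg 0%N (m + s0)%N) <= eta' / 8.
  by move: lenm; rewrite le_min => /andP[].
pose P (y y' : R) := exists x x', [/\ lim_set (tail (m + s0) V) x,
  lim_set (tail (n + s0) V) x', y = comp v x, y' = comp v x' &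
  iter l h (comp (seg 0%N m) y) = comp (seg 0%N n) y'].
have inC k x : lim_set (tail (k + s0) V) x -> lim_set V (comp (seg 0%N (k + s0)%N) x).
  move=> Vx; apply: (lim_word_map sp); first exact: (seg_matches wV 0 (k + s0)).
  by rewrite size_seg.
have cat_m x : comp (seg 0%N m) (comp v x) = comp (seg 0%N (m + s0)%N) x.
  by rewrite sE word_map_cat -vm.
have cat_n x : comp (seg 0%N n) (comp v x) = comp (seg 0%N (n + s0)%N) x.
  by rewrite sE word_map_cat -vn.
have near_z k x : Itv x ->
    `|comp (seg 0%N (k + s0)%N) x - z| <= cyl_len (seg 0%N (k + s0)%N).
  by move=> Ix; rewrite (zE (k + s0)%N); exact: (cyl_dist sp _ Ix (Iorb (k + s0)%N)).
have orb_m : orb m = comp v (orb (m + s0)%N) by rewrite vm -orbE.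
have orb_n : orb n = comp v (orb (n + s0)%N) by rewrite vn -orbE.
have Cz := lf_in lf.
have zz : `|z - z| <= eta by rewrite subrr normr0 ltW.
apply: (rigid P v).
  move=> y1 y1' y2 y2' [x1 [x1' [Vx1 Vx1' -> -> E1]]] [x2 [x2' [Vx2 Vx2' -> -> E2]]].
  have near x : lim_set (tail (m + s0) V) x ->
      lim_set V (comp (seg 0%N m) (comp v x)) /\
      `|comp (seg 0%N m) (comp v x) - z| <= eta.
    move=> Vx; rewrite cat_m; split; first exact: inC.
    exact: le_trans (near_z m _ (lim_subI Vx)) lenm1.
  have [C1 n1] := near _ Vx1; have [C2 n2] := near _ Vx2.
  have := lin l _ _ C1 C2 n1 n2; rewrite E1 E2 => h1.
  have h2 := affn _ _ (lim_subI Vx1') (lim_subI Vx2').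
  have h3 := logcloseMl (lam ^+ l) (affm _ _ (lim_subI Vx1) (lim_subI Vx2)).
  have h4 := logcloseMr (comp v x1 - comp v x2) blb.
  rewrite mulrA in h3.
  have h5 := logclose_trans (logclose_sym h2)
    (logclose_trans h1 (logclose_trans h3 h4)).
  have h6 := logcloseMI _ h5; rewrite gt_eqF// in h6.
  apply: le_trans (logclose_dist _ (h6 isT)) _; first lra.
  by rewrite ler_wpM2r//; lra.
split.
  (* The image of a point of the first cylinder lies where the affine
     approximation of the second prefix predicts a point of the second one. *)
  move=> x Vx; have Ix := lim_subI Vx.
  pose X := comp (seg 0%N m) (comp v x).
  have CX : lim_set V X by rewrite /X cat_m; exact: inC.
  have Xz : `|X - z| <= eta.
    by rewrite /X cat_m; exact: le_trans (near_z m _ Ix) lenm1.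
  have h1 := lin l _ _ CX Cz Xz zz; rewrite (lf_iter_fix lf) in h1.
  have h2 := affm _ _ Ix (Iorb (m + s0)%N); rewrite -orb_m -(zE m) -/X in h2.
  have h3 := logcloseMl (lam ^+ l) h2.
  have h4 := logcloseMr (comp v x - orb m) blb.
  rewrite mulrA in h3.
  have h5 := logclose_trans h1 (logclose_trans h3 h4).
  rewrite orb_m in h5.
  have [] := locn x (orb (m + s0)%N) (iter l h X) Ix (Iorb _) _
    (lf_iter_stable lf l CX) _.
  - by rewrite -orb_m distrC.
  - by apply: le_logclose h5; lra.
  move=> x' Vx' Yx'; exists x' => //.
  by exists x, x'; split.
(* Conversely the second cylinder is so small compared with [lam ^+ l] that
   its points have preimages under [iter l h] in the domain of linearity. *)
move=> x' Vx'; have Ix' := lim_subI Vx'.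
pose Y := comp (seg 0%N n) (comp v x').
have CY : lim_set V Y by rewrite /Y cat_n; exact: inC.
have h1 := affn _ _ Ix' (Iorb (n + s0)%N); rewrite -orb_n -(zE n) -/Y in h1.
have Yz : `|Y - z| <= eta' * lam ^+ l.
  rewrite /Y cat_n; apply: le_trans (near_z n _ Ix') _.
  have k1 := affn _ _ (I_right sp) (I_left sp).
  rewrite !cat_n -/(cyl_len (seg 0%N (n + s0)%N)) -/(cyl_len v) in k1.
  have k2 := affm _ _ (I_right sp) (I_left sp).
  rewrite !cat_m -/(cyl_len (seg 0%N (m + s0)%N)) -/(cyl_len v) in k2.
  have k3 := logcloseMr (cyl_len v) (logclose_sym blb).
  have k4 := logcloseMl (lam ^+ l) (logclose_sym k2); rewrite mulrA in k4.
  have k5 := logclose_trans k1 (logclose_trans k3 k4).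
  have lenm0 := cyl_len_gt0 sp (seg 0%N (m + s0)%N).
  have l0 : 0 < lam ^+ l by rewrite exprn_gt0.
  have k6 : e + (e + e) <= 1 / 2 by lra.
  have := logclose_dist k6 k5.
  rewrite (gtr0_norm (mulr_gt0 l0 lenm0)) ler_norml => /andP[_ k7].
  have k8 : lam ^+ l * cyl_len (seg 0%N (m + s0)%N) <= lam ^+ l * (eta' / 8).
    by rewrite ler_pM2l.
  have := mulr_gt0 l0 lenm0; nra.
have [X [CX Xz XY]] := pre l Y CY Yz.
have h2 := lin l _ _ CX Cz Xz zz; rewrite (lf_iter_fix lf) XY in h2.
have h3 := logcloseMr (comp v x' - orb n) (logclose_sym blb).
have h4 := logclose_trans (logclose_sym h2) (logclose_trans h1 h3).
rewrite -mulrA in h4; have h5 := logcloseMI _ h4.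
rewrite gt_eqF ?exprn_gt0// in h5.
have [] := locm x' (orb (n + s0)%N) X Ix' (Iorb _) _ CX _.
- by rewrite -orb_n.
- by rewrite -orb_n; apply: le_logclose (h5 isT); lra.
move=> x Vx XE; exists x => //; exists x, x'; split=> //.
by rewrite -XE XY.
Qed.

End Recurrence.

(** * Finite unions of intervals and limit sets of a single system *)

Lemma common_pos_bound (R : realType) (T : finType) (d : T -> R) :
  (forall i, 0 < d i) -> exists2 e, 0 < e & forall i, e <= d i.
Proof.
move=> d0; exists (\big[Num.min/1]_i d i); last by move=> i; exact: bigmin_le.
by elim/big_ind : _ => // x y x0 y0; rewrite lt_min x0 y0.
Qed.

Lemma powR_small (R : realType) (M al e : R) : 0 <= M -> 0 < al -> 0 < e ->
  exists2 d, 0 < d & forall t, 0 <= t -> t <= d -> M * t `^ al <= e.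
Proof.
move=> M0 al0 e0; have M1 : 0 < M + 1 by lra.
exists ((e / (M + 1)) `^ al^-1); first by rewrite powR_gt0 ?divr_gt0.
move=> t t0 td; apply: le_trans (_ : M * (e / (M + 1)) <= _); last first.
  by rewrite mulrA ler_pdivrMr//; lra.
rewrite ler_wpM2l//; apply: le_trans (_ : ((e / (M + 1)) `^ al^-1) `^ al <= _).
  by apply: ge0_ler_powR => //; rewrite ?nnegrE ?powR_ge0 ?(ltW al0).
by rewrite -powRrM mulVf ?gt_eqF// powRr1// divr_ge0 ?ltW.
Qed.

Section FiniteUnion.
Context {R : realType} (n : nat) (a b : 'I_n.+1 -> R).
Context (ab : forall i, a i < b i).

Let D : set R := \bigcup_i `[a i, b i]%classic.

Lemma finite_union_compact : compact D.
Proof.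
have -> : D = \big[setU/set0]_(i <- enum 'I_n.+1 | true) `[a i, b i]%classic.
  rewrite -bigcup_seq; apply/seteqP; split => x [i Di xi]; exists i => //=.
  by rewrite mem_enum.
by apply: bigsetU_compact => i _; exact: segment_compact.
Qed.

(** Near [z] only the intervals that contain [z] matter, and the union of these
    is an interval. *)
Lemma local_interval z : D z -> exists2 dl, 0 < dl & forall eta, 0 < eta -> eta <= dl ->
  exists u v, u < v /\ forall x, x \in `[u, v] <-> D x /\ `|x - z| <= eta.
Proof.
move=> [k _]; rewrite /= in_itv /= => /andP[akz zbk].
have [dl dl0 dlP] : exists2 dl, 0 < dl &
    forall i x, a i <= x <= b i -> `|x - z| <= dl -> a i <= z <= b i.
  have sep i : exists dl, 0 < dl /\
      forall x, a i <= x <= b i -> `|x - z| <= dl -> a i <= z <= b i.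
    have [az|za] := leP (a i) z; last first.
      exists ((a i - z) / 2); split; first lra.
      by move=> x /andP[? ?]; rewrite ler_norml => /andP[? ?]; lra.
    have [zb|bz] := leP z (b i); first by exists 1.
    exists ((z - b i) / 2); split; first lra.
    by move=> x /andP[? ?]; rewrite ler_norml => /andP[? ?]; lra.
  have /choice [d dP] := sep.
  have [dl dl0 dld] := common_pos_bound (fun i => proj1 (dP i)).
  by exists dl => // i x xi xz; apply: (proj2 (dP i) x xi (le_trans xz (dld i))).
exists dl => // eta eta0 etadl.
have kz : a k <= z <= b k by rewrite akz zbk.
have [i iz imin] := arg_minP (i0 := k) (P := fun i => a i <= z <= b i) a kz.
have [j jz jmax] :=
  arg_minP (i0 := k) (P := fun i => a i <= z <= b i) (fun i => - b i) kz.
have /andP[ai zi] := iz; have /andP[aj zj] := jz.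
have aik := imin k kz; have bkj := jmax k kz.
have abk := ab k.
have lmax (x y t : R) : (Num.max x y <= t) = (x <= t) && (y <= t) by rewrite ge_max.
exists (Num.max (a i) (z - eta)), (Num.min (b j) (z + eta)); split.
  by rewrite gt_max !lt_min; apply/andP; split; apply/andP; split; lra.
move=> x; rewrite in_itv /= ge_max le_min; split.
  move=> /andP[/andP[x1 x2] /andP[x3 x4]]; split; last first.
    by rewrite ler_norml; apply/andP; split; lra.
  have [xz|/ltW zx] := leP x z.
    by exists i => //=; rewrite in_itv /= x1 (le_trans xz).
  by exists j => //=; rewrite in_itv /= x3 (le_trans aj).
move=> [[l _]] /=; rewrite in_itv /= => xl xz.
have lz := dlP l x xl (le_trans xz etadl).
have := imin l lz; have := jmax l lz.
have /andP[x1 x2] := xl; move: xz; rewrite ler_norml => /andP[x3 x4] h1 h2.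
by apply/andP; split; apply/andP; split; lra.
Qed.

End FiniteUnion.

Section IfsLimitSet.
Context {R : realType} (D : set R) (H : ifs D).

Lemma limit_set_sub : limit_set H `<=` D.
Proof. by move=> x /(_ 0%N Logic.I). Qed.

Lemma limit_set_stable i x : limit_set H x -> limit_set H (H i x).
Proof.
move=> Hx [|n] _ /=; first exact: (ifs_maps_to i (limit_set_sub Hx)).
by exists i => //; exists x => //; exact: Hx.
Qed.

Lemma limit_set_fixed i z : D z -> H i z = z -> limit_set H z.
Proof.
move=> Dz zE n _; elim: n => //= n IH.
by exists i => //; exists z.
Qed.

(** As for sequences of systems, disjointness and injectivity make the
    letter and the preimage independent of the rank. *)
Lemma limit_set_preimage : (forall i, {in D &, injective (H i)}) ->
  forall x, limit_set H x -> exists i y, limit_set H y /\ x = H i y.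
Proof.
move=> inj x Hx; have [i _ [y Dy yE]] := Hx 1%N Logic.I.
exists i, y; split => // n _; have [j _ [y' Hy' yE']] := Hx n.+1 Logic.I.
have Dy' : D y'.
  elim: n y' {yE'} Hy' => //= n IH y' [k _ [y2 /IH Dy2 <-]]; exact: ifs_maps_to.
have ij : i = j.
  apply/eqP/negPn/negP => /ifs_disjoint ij0.
  suff : set0 x by []; rewrite -ij0; split; [by exists y|by exists y'].
suff -> : y = y' by [].
by subst j; apply: (inj i); rewrite ?inE// yE yE'.
Qed.

Lemma ifs_fixpoint i : exists2 z, D z & H i z = z.
Proof.
have [n [a [b [ab DE]]]] := ifs_domain H.
have clD : closed D.
  apply: compact_closed; first exact: norm_hausdorff.
  by rewrite DE; exact: finite_union_compact.
have D0 : D !=set0.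
  exists (a ord0); rewrite DE; exists ord0 => //=.
  by rewrite in_itv /= lexx ltW.
have [q q1 lip] := ifs_contracting i.
have hom : {homo H i : x / D x >-> D x} by move=> x; exact: ifs_maps_to.
have ctr : is_contraction (mkfun_fun hom).
  have q0 : 0 <= Num.max q 0 by rewrite le_max lexx orbT.
  exists (NngNum q0); split => /=; first by rewrite gt_max q1 ltr01.
  move=> p Dp /=; apply: le_trans (lip p Dp) _.
  by rewrite ler_wpM2r// le_max lexx.
by have [p Dp pE] := banach_fixed_point ctr clD D0; exists p.
Qed.

End IfsLimitSet.

(** * A linearizable fixed point in the limit set of a smooth system *)

(** Values within half of [`|d|] of [d] have the sign of [d]. *)
Lemma same_sign (R : realType) (d x y : R) : d != 0 ->
  `|x - d| <= `|d| / 2 -> `|y - d| <= `|d| / 2 -> 0 < x * y.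
Proof.
rewrite neq_lt => /orP[d0|d0].
  rewrite (ltr0_norm d0) !ler_norml => /andP[? ?] /andP[? ?].
  by rewrite -mulrNN mulr_gt0// oppr_gt0; lra.
rewrite (gtr0_norm d0) !ler_norml => /andP[? ?] /andP[? ?].
by rewrite mulr_gt0//; lra.
Qed.

Section IfsFixpoint.
Context {R : realType} (D : set R) (H : ifs D) (beta : R).
Context (beta0 : 0 < beta) (diffH : C1_diffeomorphic beta H).

Lemma avoid_value i (K : set R) z : K `<=` D -> compact K ->
    (forall x, K x -> H i x <> z) ->
  exists2 dl, 0 < dl & forall x, K x -> ~ (`|H i x - z| <= dl).
Proof.
move=> KD cK Kz.
have /closed_openC op : closed (H i @` K).
  apply: compact_closed; first exact: norm_hausdorff.
  apply: continuous_compact cK; apply: continuous_subspaceW KD _.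
  exact: ifs_continuous.
have Cz : (~` (H i @` K)) z by move=> [x Kx]; exact: Kz.
have /nbhs_ballP [e /= e0 eP] := open_nbhs_nbhs (conj op Cz).
exists (e / 2); first by rewrite divr_gt0.
move=> x Kx xz; apply: (eP (H i x)); last by exists x.
by rewrite /ball /= distrC (le_lt_trans xz)//; lra.
Qed.

(** The points of [D] at distance at least [eta] from [z], and the whole of [D]
    for the other maps, are compact sets whose images avoid [z]. *)
Lemma ifs_preimage_near i0 z eta : D z -> H i0 z = z -> 0 < eta ->
  exists2 dl, 0 < dl & forall i x, D x -> `|H i x - z| <= dl ->
    i = i0 /\ `|x - z| <= eta.
Proof.
move=> Dz hz eta0.
have [n [a [b [ab DE]]]] := ifs_domain H.
have cD : compact D by rewrite DE; exact: finite_union_compact.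
have sep i : exists dl, 0 < dl /\ forall x, D x -> `|H i x - z| <= dl ->
    i = i0 /\ `|x - z| <= eta.
  have [->|ii0] := eqVneq i i0.
    have clo : closed (~` ball z eta) by apply: open_closedC; exact: ball_open.
    have Kz x : (D `&` ~` ball z eta) x -> H i0 x <> z.
      move=> [Dx xz] hx; have [inj _ _ _] := diffH i0; apply: xz.
      have -> : x = z by apply: inj; rewrite ?inE// hx hz.
      exact: ballxx.
    have [dl dl0 dlP] := avoid_value (@subIsetl _ _ _) (compact_closedI cD clo) Kz.
    exists dl; split=> // x Dx xz; split=> //; rewrite leNgt; apply/negP => zx.
    apply: (dlP x) => //; split=> //.
    by rewrite /ball /= distrC => /lt_trans /(_ zx); rewrite ltxx.
  have [dl dl0 dlP] : exists2 dl, 0 < dl & forall x, D x -> ~ (`|H i x - z| <= dl).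
    apply: avoid_value => // x Dx hx.
    suff : set0 z by []; rewrite -(ifs_disjoint ii0).
    by split; [exists x|exists z].
  by exists dl; split=> // x Dx /(dlP x Dx).
have /choice [d dP] := sep.
have [dl dl0 dld] := common_pos_bound (fun i => proj1 (dP i)).
by exists dl => // i x Dx xz; apply: (proj2 (dP i)) => //; exact: le_trans (dld i).
Qed.

(** The square of a map is used so that the multiplier is positive.  The linear
    estimate is [word_slope] for the words of a single letter on a small interval
    around the fixed point: there the product of derivatives is exactly a power of
    the multiplier. *)
Lemma ifs_linear_fixpoint : exists h z lam, linear_fixpoint (limit_set H) h z lam.
Proof.
have [z Dz hz] := ifs_fixpoint (ord0 : 'I_(ifs_pred_size H).+1); set h0 := H ord0 in hz.
have [inj der nz [M0 hol0]] := diffH ord0.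
pose dh := derive_in D h0; rewrite -/h0 -/dh in hol0 der nz.
pose M := `|M0|; pose l := `|dh z| / 2.
have M_ge0 : 0 <= M := normr_ge0 M0.
have hol x y : D x -> D y -> `|dh x - dh y| <= M * `|x - y| `^ beta.
  move=> Dx Dy; apply: le_trans (hol0 x y Dx Dy) _.
  by rewrite ler_wpM2r ?powR_ge0// ler_norm.
have dz0 : dh z != 0 by exact: nz.
have l0 : 0 < l by rewrite divr_gt0// normr_gt0.
have [q q1 lip] := ifs_contracting (ord0 : 'I_(ifs_pred_size H).+1).
(* Powers of the contraction factor with exponent [beta] need it to be positive. *)
pose q' := Num.max q (1 / 2).
have q'01 : 0 < q' < 1.
  by rewrite lt_max gt_max q1; apply/andP; split; [apply/orP; right|]; lra.
have contr x y : D x -> D y -> `|h0 x - h0 y| <= q' * `|x - y|.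
  move=> Dx Dy; apply: le_trans (lip (x, y) (conj Dx Dy)) _.
  by rewrite ler_wpM2r// le_max lexx.
have [n [a [b [ab DE]]]] := ifs_domain H.
have [dl dl0 dlP] : exists2 dl, 0 < dl & forall eta, 0 < eta -> eta <= dl ->
  exists u v, u < v /\ forall x, x \in `[u, v] <-> D x /\ `|x - z| <= eta.
  by rewrite DE; apply: local_interval => //; rewrite -DE.
have [d1 d10 d1P] := powR_small M_ge0 beta0 l0.
pose eta := Num.min dl d1.
have eta0 : 0 < eta by rewrite lt_min dl0.
have [u [v [uv uvP]]] := dlP eta eta0 ltac:(by rewrite ge_min lexx).
have uvD : `[u, v]%classic `<=` D by move=> x /uvP [].
have dclose x : x \in `[u, v] -> `|dh x - dh z| <= l.
  move=> /uvP [Dx xz]; apply: le_trans (hol x z Dx Dz) (d1P _ _ _) => //.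
  by apply: le_trans xz _; rewrite ge_min lexx orbT.
have zuv : z \in `[u, v] by apply/uvP; rewrite subrr normr0 ltW.
have dlow x : x \in `[u, v] -> l <= `|dh x|.
  move=> /dclose; rewrite /l => hx.
  have := ler_dist_dist (dh z) (dh x).
  by rewrite distrC in hx => hy; have := le_trans (ler_norm _) (le_trans hy hx); lra.
have dsign x y : x \in `[u, v] -> y \in `[u, v] -> 0 < dh x * dh y.
  by move=> /dclose hx /dclose hy; exact: same_sign dz0 hx hy.
have na : nearly_affine `[u, v]%classic (fun _ : unit => h0) (fun=> dh) q' (M / l) beta.
  split => //.
  - by rewrite divr_ge0// ltW.
  - move=> _ x /uvP [Dx xz]; apply/uvP; split; first exact: ifs_maps_to.
    rewrite -{1}hz; apply: le_trans (contr x z Dx Dz) (le_trans _ xz).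
    by rewrite ler_piMl// ltW//; case/andP: q'01.
  - by move=> _ x y /uvD Dx /uvD Dy; exact: contr.
  - move=> _ x0 d x y x0uv xuv yuv.
    apply: (@holder_slope R D h0 u v M l beta) => //; first exact: ltW.
    + exact: ifs_continuous.
    + by move=> t /uvD /der.
    + by move=> s t /uvD Ds /uvD Dt; exact: hol.
have witer k x : word_map (fun _ : unit => h0) (nseq k tt) x = iter k h0 x.
  by elim: k => //= k ->.
have ziter k : iter k h0 z = z by elim: k => //= k ->.
have wslopeE k : word_deriv (fun _ : unit => h0) (fun=> dh) (nseq k tt) z = dh z ^+ k.
  by elim: k => //= k ->; rewrite witer ziter exprS.
have iter2 k x : iter k (h0 \o h0) x = iter (2 * k)%N h0 x.
  by elim: k => [|k IH]; rewrite ?muln0// mulnS /= IH.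
(* At points close to [z] the linear estimate compares [`|dh z|] with the
   contraction factor, up to a factor that tends to 1. *)
have dlt1 : `|dh z| < 1.
  have /andP[q'0 q'1] := q'01; have lnq := ln_lt0 q'01.
  have E0 : 0 < - ln q' / 2 by rewrite divr_gt0// oppr_gt0.
  have Ml0 : 0 <= M / l by rewrite divr_ge0// ltW.
  have [d2 d20 d2P] := powR_small Ml0 beta0 E0.
  have m0 : 0 < Num.min eta d2 by rewrite lt_min eta0.
  have mdl : Num.min eta d2 <= dl by rewrite !ge_min lexx.
  have [u2 [v2 [uv2 uv2P]]] := dlP _ m0 mdl.
  have [x [xz xuv]] : exists x, x != z /\ x \in `[u2, v2].
    have [uz|uz] := eqVneq u2 z.
      by exists v2; rewrite gt_eqF -?uz// in_itv /= lexx ltW.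
    by exists u2; rewrite uz in_itv /= lexx ltW.
  have [Dx xzm] := (uv2P x).1 xuv.
  have [xe xd] : `|x - z| <= eta /\ `|x - z| <= d2.
    by move: xzm; rewrite le_min => /andP[].
  have xuv' : x \in `[u, v] by apply/uvP.
  have := na_slope na tt zuv xuv' zuv (lexx _) ltac:(by rewrite subrr normr0).
  move=> /(le_logclose (d2P _ (normr_ge0 _) xd)) /logclose_norm_ge.
  rewrite /= hz normrM => h1.
  have h2 := contr x z Dx Dz; rewrite hz in h2.
  have xz0 : 0 < `|x - z| by rewrite normr_gt0 subr_eq0.
  have h3 : `|dh z| * `|x - z| <= expR (- ln q' / 2) * q' * `|x - z|.
    by apply: le_trans h1 _; rewrite -mulrA ler_pM2l ?expR_gt0.
  rewrite ler_pM2r// in h3; apply: le_lt_trans h3 _.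
  rewrite -{2}[q']lnK ?posrE// -expRD expR_lt1; lra.
exists (h0 \o h0), z, (dh z ^+ 2); split.
- exact: limit_set_fixed Dz hz.
- by rewrite /= !hz.
- by move=> x Cx; do 2 apply: limit_set_stable.
- rewrite exprn_even_gt0//= dz0 /= -real_normK ?num_real//.
  by rewrite expr_lt1.
- move=> e e0.
  have [d3 d30 d3P] := powR_small (affine_error_ge0 na) beta0 e0.
  exists (Num.min eta d3); first by rewrite lt_min eta0.
  move=> k x y Cx Cy; rewrite le_min => /andP[xe xd]; rewrite le_min => /andP[ye yd].
  have xuv : x \in `[u, v] by apply/uvP; split=> //; exact: (limit_set_sub Cx).
  have yuv : y \in `[u, v] by apply/uvP; split=> //; exact: (limit_set_sub Cy).
  have := word_slope na (nseq (2 * k)%N tt) zuv xuv yuv xd yd.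
  rewrite !witer wslopeE !iter2 exprM.
  by apply: le_logclose; apply: d3P => //; exact: ltW.
- have pre1 e : 0 < e -> exists2 e', 0 < e' & forall y, limit_set H y ->
      `|y - z| <= e' -> exists x, [/\ limit_set H x, `|x - z| <= e & h0 x = y].
    move=> e0; have [d d0 dP] := ifs_preimage_near Dz hz e0.
    exists d => // y Cy yz.
    have injH i : {in D &, injective (H i)} by case: (diffH i).
    have [i [x [Cx yE]]] := limit_set_preimage injH Cy.
    rewrite yE in yz; have [ii xz] := dP i x (limit_set_sub Cx) yz.
    by exists x; split=> //; rewrite yE ii.
  move=> e /pre1 [e1 /pre1 [e2 e20 P2] P1]; exists e2 => // y Cy /(P2 y Cy).
  move=> [x1 [Cx1 x1z <-]]; have [x [Cx xz <-]] := P1 x1 Cx1 x1z.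
  by exists x.
Qed.

End IfsFixpoint.

(** * Two smooth systems on an interval *)

Lemma hoelder_continuous (R : realType) (D : set R) (al : R) (f : R -> R) :
  0 < al -> hoelder_on D al f -> {within D, continuous f}.
Proof.
move=> al0 [M hol]; apply/subspace_continuousP => x Dx; apply/cvgrPdist_le => e e0.
have [d d0 dP] := powR_small (normr_ge0 M) al0 e0.
apply/nbhs_ballP; exists d => //= y xy Dy; apply: le_trans (hol x y Dx Dy) _.
apply: le_trans (dP _ (normr_ge0 _) (ltW xy)).
by rewrite ler_wpM2r ?powR_ge0// ler_norm.
Qed.

(** What a single map contributes to [nearly_affine], together with
    monotonicity. *)
Record increasing_branch {R : realType} (a b al q M : R) (f df : R -> R) : Prop :=
  IncreasingBranch {
  ib_mono : forall x y, x \in `[a, b] -> y \in `[a, b] -> x <= y -> f x <= f y;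
  ib_contract : forall x y, x \in `[a, b] -> y \in `[a, b] ->
    `|f x - f y| <= q * `|x - y|;
  ib_slope : forall x0 d x y, x0 \in `[a, b] -> x \in `[a, b] -> y \in `[a, b] ->
    `|x - x0| <= d -> `|y - x0| <= d ->
    logclose (M * d `^ al) (f x - f y) (df x0 * (x - y)) }.

Lemma diffeo_increasing_branch (R : realType) (a b al : R) (f : R -> R) :
    a < b -> 0 < al -> {within `[a, b], continuous f} ->
    C1_diffeo_on `[a, b]%classic al f ->
    (forall x, x \in `[a, b] -> 0 < derive_in `[a, b]%classic f x < 1 / 2) ->
  exists q M, [/\ 0 < q < 1 / 2, 0 <= M &
    increasing_branch a b al q M f (derive_in `[a, b]%classic f)].
Proof.
move=> ab al0 fc [_ der _ hol] d01.
set df := derive_in _ f in hol d01 *.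
have dfc := hoelder_continuous al0 hol; have [M0 holM] := hol.
have [xm xmab xmP] := EVT_min (ltW ab) dfc.
have [xM xMab xMP] := EVT_max (ltW ab) dfc.
have /andP[q0 q2] := d01 _ xMab; have /andP[l0 _] := d01 _ xmab.
have mvt := MVT_in (@subset_refl _ _) fc der.
have Ml0 : 0 <= `|M0| / df xm by rewrite divr_ge0// ltW.
exists (df xM), (`|M0| / df xm); split => //; first by rewrite q0.
have sub u v xi : u \in `[a, b] -> v \in `[a, b] -> xi \in `]u, v[ -> xi \in `[a, b].
  rewrite !in_itv /= => /andP[? ?] /andP[? ?] /andP[? ?].
  by apply/andP; split; lra.
have mono x y : x \in `[a, b] -> y \in `[a, b] -> x <= y ->
    0 <= f y - f x <= df xM * (y - x).
  move=> xab yab; rewrite le_eqVlt => /predU1P[->|xy].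
    by rewrite !subrr mulr0 lexx.
  have [xi xixy ->] := mvt x y xab yab xy.
  have xiab := sub _ _ _ xab yab xixy.
  have xy0 : 0 < y - x by rewrite subr_gt0.
  by rewrite ler_pM2r// xMP// mulr_ge0 ?(ltW xy0)// ltW//; case/andP: (d01 _ xiab).
split.
- by move=> x y xab yab xy; rewrite -subr_ge0; case/andP: (mono x y xab yab xy).
- move=> x y xab yab.
  wlog xy : x y xab yab / x <= y => [W|].
    have [xy|/ltW yx] := leP x y; first exact: W.
    by rewrite distrC [`|x - y|]distrC; exact: W.
  have /andP[m1 m2] := mono x y xab yab xy.
  by rewrite distrC [`|x - y|]distrC !ger0_norm// subr_ge0.
- apply: (@holder_slope R `[a, b]%classic f a b `|M0| (df xm) al) => //.
  + exact: ltW.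
  + move=> x xab; have /andP[? _] := d01 x xab.
    by rewrite ger0_norm ?xmP// ltW.
  + move=> x y xab yab; have /andP[? _] := d01 x xab; have /andP[? _] := d01 y yab.
    exact: mulr_gt0.
  + move=> x y xab yab; apply: le_trans (holM x y xab yab) _.
    by rewrite ler_wpM2r ?powR_ge0// ler_norm.
Qed.

(** The images are disjoint intervals by the intermediate value theorem, so
    they are ordered, and the gap is the distance between facing endpoints. *)
Lemma disjoint_images_gap (R : realType) (a b : R) (f g : R -> R) :
    a < b -> {within `[a, b], continuous f} -> {within `[a, b], continuous g} ->
    (forall x y, x \in `[a, b] -> y \in `[a, b] -> x <= y -> f x <= f y) ->
    (forall x y, x \in `[a, b] -> y \in `[a, b] -> x <= y -> g x <= g y) ->
    (f @` `[a, b]) `&` (g @` `[a, b]) = set0 ->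
  exists2 d, 0 < d & forall x y, x \in `[a, b] -> y \in `[a, b] -> d <= `|f x - g y|.
Proof.
move=> ab fc gc fm gm dis.
wlog fga : f g fc gc fm gm dis / f a <= g a => [W|].
  have [fga|/ltW gfa] := leP (f a) (g a); first exact: W.
  have [d d0 dP] := W g f gc fc gm fm ltac:(by rewrite setIC) gfa.
  by exists d => // x y xab yab; rewrite distrC; exact: dP.
have aab : a \in `[a, b] by rewrite in_itv /= lexx ltW.
have bab : b \in `[a, b] by rewrite in_itv /= lexx ltW.
have fbga : f b < g a.
  rewrite ltNge; apply/negP => gafb.
  have fab := fm a b aab bab (ltW ab).
  have [x xab fx] := @IVT R f a b (g a) (ltW ab) fc
    ltac:(by rewrite ge_min le_max fga gafb orbT).
  suff : set0 (g a) by []; rewrite -dis.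
  by split; [exists x|exists a].
exists (g a - f b); first by rewrite subr_gt0.
move=> x y xab yab; rewrite distrC; apply: le_trans (ler_norm _).
have := fm x b xab bab; have := gm a y aab yab.
have /andP[ax xb] := xab; have /andP[ay yb] := yab.
by move=> /(_ ay) h1 /(_ xb) h2; lra.
Qed.

Section PairOfSystems.
Context {R : realType} (c r alpha : R) (r_gt0 : 0 < r) (alpha_gt0 : 0 < alpha).
Local Notation Itv := (`[c - r, c + r]%classic : set R).
Context (F G : ifs Itv).
Context (symF : symmetric_ifs c F) (symG : symmetric_ifs c G)
  (diffF : C1_diffeomorphic alpha F) (diffG : C1_diffeomorphic alpha G)
  (derF : forall i x, Itv x -> 0 < derive_in Itv (F i) x < 1 / 2)
  (derG : forall i x, Itv x -> 0 < derive_in Itv (G i) x < 1 / 2).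

Definition pair_letter : finType :=
  ('I_(ifs_pred_size F).+1 + 'I_(ifs_pred_size G).+1)%type.

Definition pair_kind (i : pair_letter) : bool := if i is inl _ then true else false.

Definition pair_map (i : pair_letter) : R -> R :=
  match i with inl j => F j | inr j => G j end.

Let pair_der (i : pair_letter) : R -> R := derive_in Itv (pair_map i).

Let ab : c - r < c + r. Proof. by have := r_gt0; lra. Qed.

Let pair_continuous i : {within Itv, continuous (pair_map i)}.
Proof. by case: i => i; exact: ifs_continuous. Qed.

Lemma pair_symmetric : exists q M gap,
  symmetric_pair c r pair_kind pair_map pair_der q M alpha gap.
Proof.
have der01 i x : Itv x -> 0 < pair_der i x < 1 / 2.
  by case: i => i; [exact: derF|exact: derG].
have branch i : exists qM : R * R, [/\ 0 < qM.1 < 1 / 2, 0 <= qM.2 &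
    increasing_branch (c - r) (c + r) alpha qM.1 qM.2 (pair_map i) (pair_der i)].
  have [q [M [q0 M0 br]]] : exists q M, [/\ 0 < q < 1 / 2, 0 <= M &
      increasing_branch (c - r) (c + r) alpha q M (pair_map i) (pair_der i)].
    apply: diffeo_increasing_branch => //; last by move=> x; exact: der01.
    by case: i => i; [exact: diffF|exact: diffG].
  by exists (q, M).
have /choice [qM qMP] := branch.
have [e e0 eP] : exists2 e, 0 < e & forall i, e <= 1 / 2 - (qM i).1.
  apply: common_pos_bound => i; have [/andP[_ ?] _ _] := qMP i; lra.
have [e' e'0 e'P] : exists2 e', 0 < e' & forall i, e' <= ((qM i).2 + 1)^-1.
  apply: common_pos_bound => i; have [_ ? _] := qMP i.
  by rewrite invr_gt0; lra.
have gaps (p : pair_letter * pair_letter) : exists d, 0 < d /\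
    (pair_kind p.1 = pair_kind p.2 -> p.1 != p.2 -> forall x y,
      x \in `[c - r, c + r] -> y \in `[c - r, c + r] ->
      d <= `|pair_map p.1 x - pair_map p.2 y|).
  case: p => i j /=.
  have [kij|kij] := eqVneq (pair_kind i) (pair_kind j); last first.
    by exists 1; split=> // /eqP; rewrite (negbTE kij).
  have [ij|ij] := eqVneq i j; first by exists 1; split.
  have [_ _ [mi _ _]] := qMP i; have [_ _ [mj _ _]] := qMP j.
  have [|d d0 dP] :=
    disjoint_images_gap ab (@pair_continuous i) (@pair_continuous j) mi mj.
    case: i j kij ij {mi mj} => i [] j //= _ ij; apply: ifs_disjoint;
    by apply: contraNneq ij => ->.
  by exists d; split.
have /choice [gap gapP] := gaps.
have [g g0 gP] := common_pos_bound (fun p => proj1 (gapP p)).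
have eq i : (qM i).1 <= 1 / 2 - e by have := eP i; lra.
have eM i : (qM i).2 <= e'^-1.
  have [_ M0 _] := qMP i; have := e'P i.
  rewrite -[leLHS]invrK lef_pV2 ?posrE ?invr_gt0//; last by lra.
  by move=> ?; lra.
exists (1 / 2 - e), e'^-1, g; split => //.
- split => //.
  + have [/andP[? ?] _ _] := qMP (inl ord0); have := eq (inl ord0).
    by move=> ?; apply/andP; split; lra.
  + by rewrite invr_ge0 ltW.
  + by case=> i x; exact: ifs_maps_to.
  + move=> i x y xI yI; have [_ _ [_ ct _]] := qMP i.
    by apply: le_trans (ct x y xI yI) _; rewrite ler_wpM2r.
  + move=> i x0 d x y x0I xI yI xd yd; have [_ _ [_ _ sl]] := qMP i.
    by apply: le_logclose (sl x0 d x y x0I xI yI xd yd); rewrite ler_wpM2r ?powR_ge0.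
- lra.
- move=> i x xI; have /andP[-> /lt_trans->] := der01 i x xI; lra.
- move=> i j x y kij ij xI yI; apply: le_trans (gP (i, j)) _.
  exact: (proj2 (gapP (i, j))).
- case=> i; [have [j jP] := symF i; exists (inl j)|
             have [j jP] := symG i; exists (inr j)] => //.
- by case; [exists (inl ord0)|exists (inr ord0)].
Qed.

Lemma pieces_pairF K : pieces pair_kind pair_map true K = ifs_act F K.
Proof.
apply/seteqP; split => x.
  by move=> [[i|i]] [y [//= _ Ky ->]]; exists i => //; exists y.
by move=> [i _ [y Ky <-]]; exists (inl i), y.
Qed.

Lemma pieces_pairG K : pieces pair_kind pair_map false K = ifs_act G K.
Proof.
apply/seteqP; split => x.
  by move=> [[i|i]] [y [//= _ Ky ->]]; exists i => //; exists y.
by move=> [i _ [y Ky <-]]; exists (inr i), y.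
Qed.

Lemma limit_setF : limit_set F = lim_set c r pair_kind pair_map (fun=> true).
Proof.
apply: eq_bigcapr => n _; elim: n => //= n ->; exact/esym/pieces_pairF.
Qed.

Lemma limit_setG : limit_set G = lim_set c r pair_kind pair_map (fun=> false).
Proof.
apply: eq_bigcapr => n _; elim: n => //= n ->; exact/esym/pieces_pairG.
Qed.

(** The intersection that defines the mixed limit set starts at rank 1; rank 0
    contributes the whole interval, which contains all the pieces. *)
Lemma mixed_limit_setE (W : nat -> ifs Itv) :
    (forall n, (1 <= n)%N -> W n = F \/ W n = G) ->
  mixed_limit_set W = lim_set c r pair_kind pair_map (fun n => `[< W n.+1 = F >]).
Proof.
move=> WFG.
have cylE n k : foldr (fun i K => ifs_act (W i) K) Itv (iota k.+1 n) =
    cyl c r pair_kind pair_map (fun j => `[< W (k + j).+1 = F >]) n.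
  elim: n k => //= n IH k; rewrite IH addn0.
  have -> : tail 1 (fun j => `[< W (k + j).+1 = F >]) =
      (fun j => `[< W (k.+1 + j).+1 = F >]).
    by apply/funext => j; rewrite /tail add1n addnS addSn.
  case: asboolP => [->|WF]; first by rewrite pieces_pairF.
  by have [//|->] := WFG k.+1 isT; rewrite pieces_pairG.
apply/seteqP; split => x Wx n.
  move=> _; have Wx1 : Itv x.
    have := Wx 1%N isT; rewrite (cylE 1%N 0%N) /=.
    by move=> [[i|i]] [y [_ Iy ->]]; exact: (ifs_maps_to i Iy).
  case: n => [//|n]; have := Wx n.+1 isT; by rewrite (cylE n.+1 0%N).
by move=> _; rewrite /= (cylE n 0%N); exact: Wx.
Qed.

End PairOfSystems.

Theorem theorem1p2 (R : realType) (c r alpha beta : R)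
    (r_gt0 : 0 < r)
    (alpha_itv : 0 < alpha <= 1) (beta_itv : 0 < beta <= 1)
    (F G : ifs `[c - r, c + r]%classic)
    (symF : symmetric_ifs c F) (symG : symmetric_ifs c G)
    (diffF : C1_diffeomorphic alpha F) (diffG : C1_diffeomorphic alpha G)
    (neqFG : limit_set F <> limit_set G)
    (derF : forall i x, `[c - r, c + r]%classic x ->
       0 < derive_in `[c - r, c + r]%classic (F i) x < 1 / 2)
    (derG : forall i x, `[c - r, c + r]%classic x ->
       0 < derive_in `[c - r, c + r]%classic (G i) x < 1 / 2)
    (W : nat -> ifs `[c - r, c + r]%classic)
    (WFG : forall n : nat, (1 <= n)%N -> W n = F \/ W n = G)
    (exH : exists (D : set R) (H : ifs D),
       C1_diffeomorphic beta H /\ mixed_limit_set W = limit_set H) :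
  eventually_periodic W.
Proof.
have /andP[alpha0 _] := alpha_itv; have /andP[beta0 _] := beta_itv.
have [q [M [gap sp]]] :=
  pair_symmetric r_gt0 alpha0 symF symG diffF diffG derF derG.
have [D [H [diffH WH]]] := exH.
have [h [z [lam lf]]] := ifs_linear_fixpoint beta0 diffH.
rewrite -WH (mixed_limit_setE WFG) in lf.
have neq := neqFG; rewrite (limit_setF F G) (limit_setG F G) in neq.
have [m [n [mn mnE]]] := tail_recurrence sp neq lf.
exists m.+1, (n - m)%N; split=> //; first by rewrite subn_gt0.
move=> k mk; have := mnE (k - m.+1)%N; rewrite /tail.
have e1 : (m + (k - m.+1)).+1 = k by rewrite -addSn subnKC.
have e2 : (n + (k - m.+1)).+1 = (k + (n - m))%N.
  by rewrite -{2}e1 addSn addnAC subnKC// ltnW.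
rewrite e1 e2 => bE.
have kE : W k = F <-> W (k + (n - m))%N = F.
  by split=> ?; apply/asboolP; [rewrite -bE|rewrite bE]; exact/asboolP.
have k1 : (1 <= k)%N by exact: leq_trans mk.
have k2 : (1 <= k + (n - m))%N by exact: leq_trans (leq_addr _ _).
have [kF|kG] := WFG k k1; first by rewrite kF (kE.1 kF).
have [k'F|->] := WFG _ k2; last by rewrite kG.
by rewrite k'F (kE.2 k'F).
Qed.
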